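(* Let $N\ge 2$, $m\ge 2$, let $\Omega\subset\mathbb{R}^N$ be an open bounded domain, and for each $i\in\{1,\dots,m\}$ let $p_i>1$ and let $A_i:\Omega\times\mathbb{R}\times\mathbb{R}^N\to\mathbb{R}$ be a function with $A_{i,t}=\partial A_i/\partial t$ and $a_i=\nabla_\xi A_i$; let $G:\Omega\times\mathbb{R}^m\to\mathbb{R}$ be a function with $G_i=\partial G/\partial u_i$. Suppose that for each $i\in\{1,\dots,m\}$: (a) $A_i$ is a $\mathcal{C}^1$-Carathéodory function; (b) there are positive continuous functions $\Phi_0^i,\phi_0^i,\Phi_1^i,\phi_1^i,\Phi_2^i,\phi_2^i:\mathbb{R}\to\mathbb{R}$ such that $|A_i(x,t,\xi)|\le\Phi_0^i(t)+\phi_0^i(t)|\xi|^{p_i}$, $|A_{i,t}(x,t,\xi)|\le\Phi_1^i(t)+\phi_1^i(t)|\xi|^{p_i}$, $|a_i(x,t,\xi)|\le\Phi_2^i(t)+\phi_2^i(t)|\xi|^{p_i-1}$ for a.e. $x\in\Omega$ and all $(t,\xi)\in\mathbb{R}\times\mathbb{R}^N$; and that (c) $G$ is a $\mathcal{C}^1$-Carathéodory function, $G(\cdot,\mathbf{0})\in L^\infty(\Omega)$, and $G_i(x,\mathbf{0})=0$ for a.e. $x\in\Omega$ and each $i\in\{1,\dots,m\}$; (d) there exist a constant $\sigma>0$ and, for all $i,j\in\{1,\dots,m\}$ with $j\ne i$, real numbers $q_i\ge1$, $s_{i,j}\ge0$ such that $$|G_i(x,\mathbf{u})|\le\sigma\Big(1+|u_i|^{q_i-1}+\sum_{j\ne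 i}|u_j|^{s_{i,j}}\Big)\quad\text{for a.e. }x\in\Omega\text{ and all }\mathbf{u}\in\mathbb{R}^m.$$ Let $$\mathcal{J}(\mathbf{u})=\sum_{i=1}^m\int_\Omega A_i(x,u_i,\nabla u_i)\,dx-\int_\Omega G(x,\mathbf{u})\,dx,\qquad \mathbf{u}\in X,$$ and, for $\mathbf{u},\mathbf{v}\in X$, let $$d\mathcal{J}(\mathbf{u})[\mathbf{v}]=\sum_{i=1}^m\left(\int_\Omega a_i(x,u_i,\nabla u_i)\cdot\nabla v_i\,dx+\int_\Omega A_{i,t}(x,u_i,\nabla u_i)v_i\,dx-\int_\Omega G_i(x,\mathbf{u})v_i\,dx\right).$$ Let $(\mathbf{u}_n)_n\subset X$ and $\mathbf{u}\in X$ be such that $\mathbf{u}_n\to\mathbf{u}$ strongly in $W$ and $\mathbf{u}_n\to\mathbf{u}$ a.e. in $\Omega$ as $n\to+\infty$. If there exists $M>0$ such that $\|\mathbf{u}_n\|_L\le M$ for all $n\in\mathbb{N}$, then $$\mathcal{J}(\mathbf{u}_n)\to\mathcal{J}(\mathbf{u})\quad\text{and}\quad\|d\mathcal{J}(\mathbf{u}_n)-d\mathcal{J}(\mathbf{u})\|_{X'}\to0\quad\text{as }n\to+\infty.$$ Hence, $\mathcal{J}$ is a $C^1$ functional on $X$ with Fréchet differential given by the formula for $d\mathcal{J}(\mathbf{u})[\mathbf{v}]$ above.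
   Context: Notation: $\mathbf{u}=(u_1,\dots,u_m)$, $\mathbf{0}=(0,\dots,0)\in\mathbb{R}^m$, and $|\cdot|$ is the Euclidean norm on any Euclidean space. A function $f:\Omega\times\mathbb{R}^l\to\mathbb{R}$ is a $\mathcal{C}^1$-Carathéodory function if $f(\cdot,\omega)$ is measurable for all $\omega\in\mathbb{R}^l$ and $f(x,\cdot)$ is $\mathcal{C}^1$ for a.e. $x\in\Omega$. $W_i=W_0^{1,p_i}(\Omega)$ with norm $\|u\|_{W_i}=\left(\int_\Omega|\nabla u|^{p_i}dx\right)^{1/p_i}$; $W=W_1\times\dots\times W_m$ with norm $\|\mathbf{u}\|_W=\sum_i\|u_i\|_{W_i}$; $L=L^\infty(\Omega)\times\dots\times L^\infty(\Omega)$ ($m$ factors) with norm $\|\mathbf{u}\|_L=\sum_i|u_i|_\infty$, where $|u|_\infty=\operatorname{ess\,sup}_\Omega|u|$; $X=W\cap L$ with norm $\|\mathbf{u}\|_X=\|\mathbf{u}\|_W+\|\mathbf{u}\|_L$. $X'$ is the dual space of $X$ with the dual norm $\|\cdot\|_{X'}$. *)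

(* Defs.v *)
From HB Require Import structures.
From mathcomp Require Import all_boot all_order all_algebra.
From mathcomp Require Import all_classical all_reals all_analysis.
Import Order.TTheory GRing.Theory Num.Theory.
Import numFieldNormedType.Exports.

Set Implicit Arguments.
Unset Strict Implicit.
Unset Printing Implicit Defensive.

Local Open Scope classical_set_scope.
Local Open Scope ring_scope.

(** * Lebesgue measure on R^N *)

Definition caratheodory_measure (R : realType) (T : pointedType)
    (mu : {outer_measure set T -> \bar R}) :
  {measure set (caratheodory_type mu) -> \bar R} := mu.

Section lebesgue.
Variables (R : realType) (N : nat).
Local Notation E := 'rV[R]_N.

Definition box (ab : E * E) : set E :=
  [set x | forall i, ab.1 0 i < x 0 i <= ab.2 0 i].

Definition vol (ab : E * E) : R :=
  \prod_(i < N) Num.max 0 (ab.2 0 i - ab.1 0 i).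

(* Covers are indexed by an arbitrary D : set nat, so that finite covers are
   allowed and the empty set gets measure 0 also when N = 0. *)
Definition leb_outer (X : set E) : \bar R :=
  ereal_inf [set v | exists (D : set nat) (B : nat -> E * E),
    X `<=` \bigcup_(k in D) box (B k) /\ v = \esum_(k in D) (vol (B k))%:E].

Lemma vol_ge0 ab : 0 <= vol ab.
Proof. by apply: prodr_ge0 => i _; rewrite le_max lexx. Qed.

Lemma leb_outer_ge0 X : (0 <= leb_outer X)%E.
Proof.
apply: le_ereal_inf_tmp => _ [D [B [_ ->]]]; apply: esum_ge0 => k _.
by rewrite lee_fin; exact: vol_ge0.
Qed.

Lemma leb_outer0 : leb_outer set0 = 0%E.
Proof.
apply/eqP; rewrite eq_le leb_outer_ge0 andbT.
apply: ereal_inf_lbound; exists set0, (fun=> (0, 0)).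
by split; rewrite ?bigcup_set0 ?esum_set0.
Qed.

Lemma le_leb_outer : {homo leb_outer : A B / A `<=` B >-> (A <= B)%E}.
Proof.
move=> A B AB; apply/ereal_inf_le_tmp => _ [D [C [BC ->]]].
by exists D, C; split => //; exact: subset_trans AB BC.
Qed.

Lemma leb_outer_sigma_subadditive : sigma_subadditive leb_outer.
Proof.
move=> A; have [[i ioo]|] := pselect (exists i, leb_outer (A i) = +oo%E).
  rewrite (eseries_pinfty _ _ ioo) ?leey// => n _.
  by rewrite -ltNye (lt_le_trans _ (leb_outer_ge0 _)).
rewrite -forallNE => Aoo.
suff add2e (e : {posnum R}) : (leb_outer (\bigcup_n A n) <=
    \sum_(i <oo) leb_outer (A i) + e%:num%:E)%E.
  by apply/lee_addgt0Pr => _/posnumP[].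
apply: le_trans (epsilon_trick xpredT (fun n => leb_outer_ge0 (A n)) _) => //.
have /choice[DB HDB] n : exists DB : set nat * (nat -> E * E),
    A n `<=` \bigcup_(k in DB.1) box (DB.2 k) /\
    (\esum_(k in DB.1) (vol (DB.2 k))%:E <=
     leb_outer (A n) + (e%:num / (2 ^ n.+1)%:R)%:E)%E.
  have lfin : leb_outer (A n) \is a fin_num.
    by rewrite ge0_fin_numE ?leb_outer_ge0// ltey; apply/eqP/Aoo.
  have en1 : (0 < e%:num / (2 ^ n.+1)%:R)%R by [].
  have [_ [D [B [AB ->]]] /ltW lB] := lb_ereal_inf_adherent en1 lfin.
  by exists (D, B).
pose K := [set: nat] `*`` (fun n => (DB n).1).
pose a (nj : nat * nat) := (vol ((DB nj.1).2 nj.2))%:E : \bar R.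
have a0 nj : (0 <= a nj)%E by rewrite lee_fin vol_ge0.
have /card_esym/ppcard_eqP[f] := card_nat2.
apply: (@le_trans _ _ (\esum_(nj in K) a nj)).
  apply: ereal_inf_lbound.
  exists (f @^-1` K), (fun k => (DB (f k).1).2 (f k).2); split.
    move=> x [n _ Anx]; have [j Dj Bj] := (HDB n).1 _ Anx.
    by exists (f^-1%FUN (n, j)); rewrite /K/= invK ?inE.
  apply: reindex_esum; split => //; first by move=> x y _ _; apply: (@inj _ _ setT f); rewrite inE.
  by move=> nj Knj; exists (f^-1%FUN nj); rewrite /= ?invK ?inE.
rewrite -(@esum_esum _ _ _ setT (fun n => (DB n).1) (fun n j => a (n, j)))//.
rewrite nneseries_esumT; last first.
  by move=> n; rewrite adde_ge0 ?leb_outer_ge0// lee_fin divr_ge0.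
by apply: le_esum => n _; exact: (HDB n).2.
Qed.

HB.instance Definition _ := isOuterMeasure.Build R E leb_outer
  leb_outer0 leb_outer_ge0 le_leb_outer leb_outer_sigma_subadditive.

(* R^N with the sigma-algebra of Lebesgue-measurable sets, and the (complete)
   Lebesgue measure on it. *)
Definition lebT : measurableType leb_outer.-cara := caratheodory_type leb_outer.

Definition leb : {measure set lebT -> \bar R} :=
  caratheodory_measure leb_outer.

End lebesgue.

(** * Calculus on R^n *)

Section calculus.
Variable R : realType.

Definition dotv n (v w : 'rV[R]_n) : R := \sum_(i < n) v 0 i * w 0 i.

(* The library norm on 'rV[R]_n is the sup norm. *)
Definition enorm n (v : 'rV[R]_n) : R := Num.sqrt (dotv v v).

Definition partial n (i : 'I_n) (f : 'rV[R]_n -> R) : 'rV[R]_n -> R :=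
  'D_(delta_mx 0 i) f.

Definition gradient n (f : 'rV[R]_n -> R) (x : 'rV[R]_n) : 'rV[R]_n :=
  \row_i partial i f x.

Definition C1 (V : normedModType R) (f : V -> R) : Prop :=
  (forall w, differentiable f w) /\
  (forall v, continuous (fun w => 'd f w v)).

Definition smooth n (f : 'rV[R]_n -> R) : Prop :=
  forall (s : seq 'I_n) x, differentiable (foldr (@partial n) f s) x.

Definition test_function n (Omega : set 'rV[R]_n) (f : 'rV[R]_n -> R) : Prop :=
  let supp := closure [set x | f x != 0] in
  [/\ smooth f, compact supp & supp `<=` Omega].

Definition bounded_domain n (Omega : set 'rV[R]_n) : Prop :=
  [/\ Omega !=set0, open Omega, connected Omega & bounded_set Omega].

End calculus.

(** * Function spaces *)

Section spaces.
Variables (R : realType) (N : nat) (Omega : set 'rV[R]_N).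
Local Notation E := 'rV[R]_N.
Local Notation mu := (leb R N).

Definition meas_on (f : E -> R) : Prop :=
  measurable_fun (Omega : set (lebT R N)) (f : lebT R N -> R).

Definition ae_on (P : E -> Prop) : Prop :=
  \forall x \ae mu, Omega x -> P x.

(* For p = +oo this is the essential supremum of `|f| over Omega. *)
Definition norm_Lp (p : \bar R) (f : E -> R) : \bar R :=
  'N[mu]_p[EFin \o ((f : lebT R N -> R) \_ Omega)]%E.

Definition in_Lp (p : \bar R) (f : E -> R) : Prop :=
  meas_on f /\ (norm_Lp p f < +oo)%E.

(* A Sobolev function is represented by a pair (u, g) of a function and a
   representative g of its weak gradient (see [in_W1p] below), so that g is
   determined by u almost everywhere in Omega. Functions equal almost everywhere
   are not identified: the norms below are seminorms on representatives. *)
Definition wfun : lmodType R := ((E -> R^o) * (E -> E))%type.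

Definition grad (w : wfun) : E -> E := w.2.

Definition weak_gradient (u : E -> R) (g : E -> E) : Prop :=
  forall phi, test_function Omega phi -> forall j : 'I_N,
    \int[mu]_(x in Omega) (u x * partial j phi x) =
    - \int[mu]_(x in Omega) (g x 0 j * phi x).

Definition norm_W (p : R) (w : wfun) : \bar R :=
  norm_Lp p%:E (fun x => enorm (grad w x)).

Definition in_W1p (p : R) (w : wfun) : Prop :=
  [/\ in_Lp p%:E w.1, forall j, meas_on (fun x => grad w x 0 j),
      (norm_W p w < +oo)%E & weak_gradient w.1 (grad w)].

(* W_0^{1,p}(Omega) is the closure of C_c^oo(Omega) in W^{1,p}(Omega). *)
Definition in_W01p (p : R) (w : wfun) : Prop :=
  in_W1p p w /\
  forall e : R, 0 < e -> exists phi, test_function Omega phi /\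
    let d : wfun := w - ((phi, gradient phi) : wfun) in
    (norm_Lp p%:E d.1 + norm_W p d < e%:E)%E.

Definition C1_Caratheodory (V : normedModType R) (f : E -> V -> R) : Prop :=
  (forall w, meas_on (f ^~ w)) /\ ae_on (fun x => C1 (f x)).

Section product_space.
Variables (m : nat) (p : 'I_m -> R).

Definition wfuns : lmodType R := 'I_m -> wfun.

Definition vals (u : wfuns) (x : E) : 'rV[R]_m := \row_i (u i).1 x.

Definition in_X (u : wfuns) : Prop :=
  forall i, in_W01p (p i) (u i) /\ in_Lp +oo%E (u i).1.

Definition normW (u : wfuns) : \bar R := (\sum_(i < m) norm_W (p i) (u i))%E.

Definition normL (u : wfuns) : \bar R := (\sum_(i < m) norm_Lp +oo (u i).1)%E.

Definition normX (u : wfuns) : \bar R := (normW u + normL u)%E.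

End product_space.
End spaces.

(** * C^1 functionals *)

Section functionals.
Variables (R : realType) (U : lmodType R).
(* A normed space, as a subspace S of U and its norm. *)
Variables (S : set U) (nrm : U -> \bar R).

Definition dual_norm (T : U -> R) : \bar R :=
  ereal_sup [set `|T v|%:E | v in [set v | S v /\ (nrm v <= 1)%E]].

Definition in_dual (T : U -> R) : Prop :=
  (forall (c : R) v w, S v -> S w -> T (c *: v + w) = c * T v + T w) /\
  (dual_norm T < +oo)%E.

Definition Frechet_differential (J : U -> R) (u : U) (T : U -> R) : Prop :=
  in_dual T /\
  forall e : R, 0 < e -> exists2 d : R, 0 < d &
    forall v, S v -> (nrm v < d%:E)%E ->
      (`|J (u + v) - J u - T v|%:E <= e%:E * nrm v)%E.

Definition C1_functional_with (J : U -> R) (dJ : U -> U -> R) : Prop :=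
  (forall u, S u -> Frechet_differential J u (dJ u)) /\
  (forall u, S u -> forall e : R, 0 < e -> exists2 d : R, 0 < d &
    forall w, S w -> (nrm (w - u) < d%:E)%E ->
      (dual_norm (dJ w \- dJ u)%R < e%:E)%E).

End functionals.

(** * The functional *)

Section functional.
Variables (R : realType) (N m : nat) (Omega : set 'rV[R]_N).
Local Notation E := 'rV[R]_N.
Local Notation mu := (leb R N).

Definition A_t (A : E -> R -> E -> R) (x : E) (t : R) (xi : E) : R :=
  derive1 (fun s => A x s xi) t.

Definition A_xi (A : E -> R -> E -> R) (x : E) (t : R) (xi : E) : E :=
  gradient (A x t) xi.

Definition G_u (G : E -> 'rV[R]_m -> R) (i : 'I_m) (x : E) : 'rV[R]_m -> R :=
  partial i (G x).

Definition pos_continuous (f : R -> R) : Prop :=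
  continuous f /\ forall t, 0 < f t.

Definition growth_A (p : R) (A : E -> R -> E -> R) : Prop :=
  exists Phi0 phi0 Phi1 phi1 Phi2 phi2 : R -> R,
    [/\ pos_continuous Phi0, pos_continuous phi0 & pos_continuous Phi1] /\
    [/\ pos_continuous phi1, pos_continuous Phi2 & pos_continuous phi2] /\
    ae_on Omega (fun x => forall t xi,
      [/\ `|A x t xi| <= Phi0 t + phi0 t * enorm xi `^ p,
          `|A_t A x t xi| <= Phi1 t + phi1 t * enorm xi `^ p &
          enorm (A_xi A x t xi) <= Phi2 t + phi2 t * enorm xi `^ (p - 1)]).

Definition growth_G (G : E -> 'rV[R]_m -> R) : Prop :=
  exists (sigma : R) (q : 'I_m -> R) (s : 'I_m -> 'I_m -> R),
    [/\ 0 < sigma, forall i, 1 <= q i,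
        forall i j, j != i -> 0 <= s i j &
        forall i, ae_on Omega (fun x => forall u : 'rV[R]_m,
          `|G_u G i x u| <= sigma * (1 + `|u 0 i| `^ (q i - 1) +
             \sum_(j < m | j != i) `|u 0 j| `^ (s i j)))].

Variables (A : 'I_m -> E -> R -> E -> R) (G : E -> 'rV[R]_m -> R).

Definition J (u : wfuns R N m) : R :=
  \sum_(i < m) \int[mu]_(x in Omega) A i x ((u i).1 x) (grad (u i) x)
  - \int[mu]_(x in Omega) G x (vals u x).

Definition dJ (u v : wfuns R N m) : R :=
  \sum_(i < m)
    (\int[mu]_(x in Omega)
        dotv (A_xi (A i) x ((u i).1 x) (grad (u i) x)) (grad (v i) x)
     + \int[mu]_(x in Omega)
        (A_t (A i) x ((u i).1 x) (grad (u i) x) * (v i).1 x)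
     - \int[mu]_(x in Omega) (G_u G i x (vals u x) * (v i).1 x)).

End functional.

(* Main.v *)
(* The growth conditions dominate the integrands of J and dJ by a multiple of
   an integrable envelope Q as soon as the values are bounded by M and the
   powers |grad u_i|^{p_i} are bounded by Q. From a sequence converging in W one
   extracts a subsequence whose gradients converge almost everywhere with
   sum_k |grad u_k - grad u|^p integrable; this sum provides the envelope, and
   dominated convergence applies along the subsequence. A contradiction argument
   then gives the convergence of the whole sequence. By Hoelder's inequality
   |dJ(w)[v] - dJ(u)[v]| <= gap(w,u) |v|_X, where gap(w,u) only involves the
   L^{p'}- and L^1-distances of the coefficients of dJ. Finally J(u+v) - J(u) =
   dJ(u+sv)[v] for some 0 < s < 1, by differentiation under the integral sign
   and the mean value theorem, so the convergence of gap gives Frechet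
   differentiability. *)
Require Import Defs.
From HB Require Import structures.
From mathcomp Require Import all_boot all_order all_algebra.
From mathcomp Require Import all_classical all_reals all_analysis.
From mathcomp Require Import measurable_realfun ess_sup_inf ring lra.
Import Order.TTheory GRing.Theory Num.Theory.
Import numFieldNormedType.Exports.

Set Implicit Arguments.
Unset Strict Implicit.
Unset Printing Implicit Defensive.

Local Open Scope classical_set_scope.
Local Open Scope ring_scope.

(** * Lebesgue measurability *)

(** The gradients are controlled in L^{p_i} only, so nothing dominates |grad u_n|^{p_i} along the
    whole sequence; the L^oo bound is what turns the factors Phi(t), phi(t) of the growth conditions
    into constants. All estimates are therefore made relative to a class [in_class M Q], on an
    abstract complete measure space. A state is a measurable pair (function, vector field), so the
    intermediate points u + s v are handled by measurability and bounds alone, and Sobolev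
    membership enters only when X is mapped into the classes. Completeness makes limits almost
    everywhere measurable, which covers composites such as a_i(x, u_i, grad u_i) and the partial
    derivatives, whose regularity is known for a.e. x only. Envelopes are at least 1 so that
    additive constants are absorbed. The passage from sequences to Frechet differentiability is
    again by contradiction: states at distance 1/(n+1) from u in the norms of X satisfy all the
    assumptions of the sequential statement. *)

Lemma norm_coord_le (R : realType) n (x : 'rV[R]_n) (i : 'I_n) : `|x 0 i| <= `|x|.
Proof. by rewrite /Num.norm/= mx_normrE; exact: (le_bigmax _ (fun ij =>
  `|x ij.1 ij.2|) (0, i)). Qed.

Section lebesgue_measurability.
Variables (R : realType) (N : nat).
Local Notation E := 'rV[R]_N.
Local Notation mu := (leb R N).

(** Only the i-th factor of the product sees the cut by the hyperplane x_i = c; the truncation at 0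
    in [vol] keeps the identity true when a piece is empty. *)
Lemma vol_split (a b : E) (i : 'I_N) (c : R) :
  vol (a, \row_j if j == i then Num.min (b 0 j) c else b 0 j) +
  vol (\row_j (if j == i then Num.max (a 0 j) c else a 0 j), b) = vol (a, b).
Proof.
have volE ab : vol ab = Num.max 0 (ab.2 0 i - ab.1 0 i) *
    \prod_(j < N | j != i) Num.max 0 (ab.2 0 j - ab.1 0 j).
  by rewrite /vol (bigD1 i).
rewrite !volE /= !mxE eqxx.
under eq_bigr => j /negbTE ji do rewrite mxE ji.
under [X in _ + _ * X = _]eq_bigr => j /negbTE ji do rewrite mxE ji.
rewrite -mulrDl; congr (_ * _).
by case: (leP (b 0 i) c) => ?; case: (leP (a 0 i) c) => ?; do !case: leP => ?; lra.
Qed.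

(** Caratheodory's criterion: cutting every box of a cover of X along x_i = c covers the two parts
    of X at the same total volume. Boxes being half-open, both pieces are again boxes. *)
Lemma measurable_le_coord (i : 'I_N) (c : R) :
  measurable ([set x | x 0 i <= c] : set (lebT R N)).
Proof.
apply: le_caratheodory_measurable => X.
apply: le_ereal_inf_tmp => _ [D [B [XB ->]]].
pose B1 k : E * E :=
  ((B k).1, \row_j if j == i then Num.min ((B k).2 0 j) c else (B k).2 0 j).
pose B2 k : E * E :=
  (\row_j (if j == i then Num.max ((B k).1 0 j) c else (B k).1 0 j), (B k).2).
rewrite (eq_esum (b := fun k => (vol (B1 k))%:E + (vol (B2 k))%:E)%E); last first.
  by move=> k _; rewrite -EFinD vol_split; case: (B k).
rewrite esumD; last 2 first.
- by move=> k _; rewrite lee_fin vol_ge0.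
- by move=> k _; rewrite lee_fin vol_ge0.
apply: leeD; apply: ereal_inf_lbound.
- exists D, B1; split => // x [/XB[k Dk Bkx] /= xc]; exists k => // j /=.
  have := Bkx j; rewrite mxE; case: eqP => [->|//] /andP[-> h] /=.
  by rewrite le_min h.
- exists D, B2; split => // x [/XB[k Dk Bkx] /= xc]; exists k => // j /=.
  have := Bkx j; rewrite mxE; case: eqP => [->|//] /andP[h ->] /=.
  by rewrite gt_max h andbT /= ltNge; apply/negP.
Qed.


Lemma measurable_box (ab : E * E) : measurable (box ab : set (lebT R N)).
Proof.
have -> : box ab = \bigcap_(i in [set: 'I_N])
    ((~` [set x : E | x 0 i <= ab.1 0 i]) `&` [set x : E | x 0 i <= ab.2 0 i]).
  apply/seteqP; split => x /= h i; first by move=> _; have /andP[h1 h2] := h i;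
    split => //=; apply/negP; rewrite -ltNge.
  by have [//= /negP + ->] := h i I; rewrite -ltNge => ->.
apply: fin_bigcap_measurable => // i _; apply: measurableI; first apply: measurableC;
  exact: (@measurable_le_coord i).
Qed.

(** Balls of the sup norm are cubes, so each point of U lies in a box with rational corners
    contained in U, and there are countably many such boxes. *)
Lemma open_lebesgue_measurable (U : set E) : open U -> measurable (U : set (lebT R N)).
Proof.
move=> oU.
pose B (q : 'rV[rat]_N * 'rV[rat]_N) : E * E := (map_mx ratr q.1, map_mx ratr q.2).
have -> : U = \bigcup_(q in [set q | box (B q) `<=` U]) box (B q).
  apply/seteqP; split => x; last by move=> [q /= h /h].
  move=> Ux; have /nbhs_ballP[e /= e0 eU] := open_nbhs_nbhs (conj oU Ux).
  have ha i : exists q : rat, ratr q \in `](x 0 i - e), (x 0 i)[.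
    by have [q] := rat_in_itvoo (ltac:(lra) : x 0 i - e < x 0 i); exists q.
  have hb i : exists q : rat, ratr q \in `](x 0 i), (x 0 i + e)[.
    by have [q] := rat_in_itvoo (ltac:(lra) : x 0 i < x 0 i + e); exists q.
  exists (\row_i sval (cid (ha i)), \row_i sval (cid (hb i))) => [y /= yB|i /=]; last first.
    rewrite !mxE; case: cid => a; case: cid => b /=; rewrite !in_itv/=; lra.
  apply: eU; split => // i j; rewrite ord1 -ball_normE /=.
  have := yB j; rewrite !mxE; case: cid => a; case: cid => b /=; rewrite !in_itv/=.
  rewrite ltr_norml; lra.
rewrite bigcup_mkcond; apply: countable_bigcupT_measurable => [|q]; first exact: countableP.
by case: ifP => _; [exact: measurable_box|exact: measurable0].
Qed.

Lemma bounded_lebesgue_finite (U : set E) : bounded_set U -> (mu U < +oo)%E.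
Proof.
move=> /pinfty_ex_gt0[M _ UM].
(* Boxes exclude their lower faces, hence the margin 1 around the cube of half-side M. *)
apply: (@le_lt_trans _ _ (vol ((const_mx (- M - 1), const_mx (M + 1)) : E * E))%:E);
  last exact: ltry.
apply: ereal_inf_lbound; exists [set 0%N], (fun=>
  (const_mx (- M - 1), const_mx (M + 1))); split; last first.
  by rewrite esum_set1// lee_fin vol_ge0.
move=> x Ux; exists 0%N => // i /=; rewrite !mxE.
have := le_trans (norm_coord_le x i) (UM _ Ux).
rewrite ler_norml; lra.
Qed.

Lemma leb_complete : measure_is_complete mu.
Proof. exact: measure_is_complete_caratheodory. Qed.
End lebesgue_measurability.

(** * Almost everywhere convergence *)

Section almost_everywhere_limits.
Context d (T : measurableType d) (R : realType).
Variable mu : {measure set T -> \bar R}.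
Hypothesis cmu : measure_is_complete mu.
Variables (D : set T) (mD : measurable D).

Lemma ae_ord n (P : 'I_n -> T -> Prop) : (forall i, \forall x \ae mu, D x -> P i x) ->
  \forall x \ae mu, D x -> forall i, P i x.
Proof.
move=> h; have : \forall x \ae mu, forall i, D x -> P i x by exact: filter_forall.
by apply: filterS => x + Dx i; apply.
Qed.

(** A [limn_esup] of measurable functions is measurable and agrees with f almost everywhere;
    completeness transfers measurability to f. *)
Lemma ae_cvg_measurable (f_ : nat -> T -> R) (f : T -> R) :
  (forall n, measurable_fun D (f_ n)) ->
  (\forall x \ae mu, D x -> f_ n x @[n --> \oo] --> f x) -> measurable_fun D f.
Proof.
move=> mf_ f_f; apply/measurable_EFinP.
apply: (@ae_measurable_fun _ _ _ _ cmu _ (fun x => limn_esup (fun n => (f_ n x)%:E))).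
  apply: filterS f_f => x fx Dx /=.
  have : (f_ n x)%:E @[n --> \oo] --> (f x)%:E by apply: cvg_EFin; [exact: nearW|exact: fx].
  by move=> /cvg_limn_einf_sup[_ ->].
by apply: measurable_fun_limn_esup => n; apply/measurable_EFinP.
Qed.

(** Measurability of f is supplied by [ae_cvg_measurable]. The L^1 convergence serves [gap], the
    convergence of the integrals serves [action]. *)
Lemma dominated_Rintegral (f_ : nat -> T -> R) (f H : T -> R) :
  (forall n, measurable_fun D (f_ n)) ->
  (\forall x \ae mu, D x -> f_ n x @[n --> \oo] --> f x) ->
  mu.-integrable D (EFin \o H) ->
  (\forall x \ae mu, D x -> forall n, `|f_ n x| <= H x) ->
  [/\ mu.-integrable D (EFin \o f),
      (\int[mu]_(x in D) `|f_ n x - f x|%:E)%E @[n --> \oo] --> 0%E &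
      \int[mu]_(x in D) f_ n x @[n --> \oo] --> \int[mu]_(x in D) f x].
Proof.
move=> mf_ f_f iH fH.
have mf := ae_cvg_measurable mf_ f_f.
have [//|||//||iF h0 h] := @dominated_convergence _ _ _ mu D mD (fun n => EFin \o f_ n)
  (EFin \o f) (EFin \o H).
- by move=> n; exact/measurable_EFinP.
- exact/measurable_EFinP.
- apply: filterS f_f => x fx Dx.
  by apply: cvg_EFin; [exact: nearW|exact: fx].
- by apply: filterS fH => x fx n Dx; rewrite lee_fin fx.
- split => //; apply: fine_cvg; rewrite fineK//.
  exact: integrable_fin_num.
Qed.

Lemma ae_le_integrable (f H : T -> R) : measurable_fun D f ->
  mu.-integrable D (EFin \o H) -> (\forall x \ae mu, D x -> `|f x| <= H x) ->
  mu.-integrable D (EFin \o f).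
Proof.
move=> mf iH fH; have [] // := @dominated_Rintegral (fun=> f) f H _ _ iH _.
- by apply: aeW => x _; exact: cvg_cst.
- by apply: filterS fH => x fx Dx _; exact: fx.
Qed.

Lemma ae_eq_Rintegral (f g : T -> R) : measurable_fun D g ->
  (\forall x \ae mu, D x -> f x = g x) ->
  \int[mu]_(x in D) f x = \int[mu]_(x in D) g x.
Proof.
move=> mg fg; have mf : measurable_fun D f.
  apply: (@ae_cvg_measurable (fun=> g)) => // .
  by apply: filterS fg => x /[apply] ->; exact: cvg_cst.
congr fine; apply: ae_eq_integral => //; try exact/measurable_EFinP.
by apply: filterS fg => x /[apply] ->.
Qed.

(** The pointwise sum has finite integral by exchanging sum and integral, so it is finite almost
    everywhere; it dominates every term, and the terms of a convergent series tend to 0. *)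
Lemma summable_dominated (w : nat -> T -> R) :
  (forall n, measurable_fun D (w n)) -> (forall n x, 0 <= w n x) ->
  (\sum_(n <oo) \int[mu]_(x in D) (w n x)%:E < +oo)%E ->
  exists H : T -> R, mu.-integrable D (EFin \o H) /\
    \forall x \ae mu, D x -> w n x @[n --> \oo] --> 0 /\ forall n, 0 <= w n x <= H x.
Proof.
move=> mw w0 sw.
pose S x : \bar R := (\sum_(n <oo) (w n x)%:E)%E.
have S0 x : (0 <= S x)%E by apply: nneseries_ge0 => n _ _; rewrite lee_fin.
have mS : measurable_fun D S.
  apply: (@ge0_emeasurable_sum _ _ _ D (fun n x => (w n x)%:E) xpredT) => // n.
  - by move=> x _ _; rewrite lee_fin.
  - by move=> _; exact/measurable_EFinP.
have iS : mu.-integrable D S.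
  apply/integrableP; split => //.
  under eq_integral do rewrite gee0_abs//.
  rewrite integral_nneseries// => n; first exact/measurable_EFinP.
  by move=> x _; rewrite lee_fin.
have fS := integrable_ae mD iS.
exists (fine \o S); split.
  have mfS : measurable_fun D (EFin \o (fine \o S)).
    by apply/measurable_EFinP; apply: measurableT_comp mS; exact: fine_measurable.
  apply: le_integrable iS => // x _ /=; rewrite gee0_abs// ger0_norm ?fine_ge0//.
  by case: (S x) (S0 x) => //= _; rewrite leey.
apply: filterS fS => x /[apply] Sfin; split; last first.
  move=> n; rewrite w0/= -lee_fin fineK//.
  (* The partial sum of length [n.+1] is the first to contain the term of index n. *)
  apply: le_trans (nneseries_lim_ge n.+1 _) => [|k _ _]; last by rewrite lee_fin.
  by rewrite big_nat_recr//= leeDr// sume_ge0// => k _; rewrite lee_fin.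
apply: cvg_series_cvg_0; apply: nondecreasing_is_cvgn.
  by apply/nondecreasing_seqP => n; rewrite /series/= big_nat_recr//= lerDl.
exists (fine (S x)) => _ [n _ <-]; rewrite -lee_fin fineK// /series/= -sumEFin.
by apply: nneseries_lim_ge => k _ _; rewrite lee_fin.
Qed.
End almost_everywhere_limits.

(** * Caratheodory functions *)

Lemma cvg_row (R : realType) n (f : nat -> 'rV[R]_n) (l : 'rV[R]_n) :
  (forall j, f k 0 j @[k --> \oo] --> l 0 j) -> f @ \oo --> l.
Proof.
move=> fl; apply/cvgrPdist_le => e e0.
have : \forall k \near \oo, forall j, `|l 0 j - f k 0 j| <= e.
  by apply: filter_forall => j; move/cvgrPdist_le : (fl j) => /(_ _ e0).
apply: filterS => k h; rewrite /Num.norm/= mx_normrE; apply: bigmax_le; first exact: ltW.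
by move=> [i j] _ /=; rewrite !mxE (ord1 i); exact: h.
Qed.

Section line_derivative.
Variables (R : realType) (V : normedModType R).

Lemma is_derive_line (f : V -> R) (w v : V) (s : R) : differentiable f (w + s *: v) ->
  is_derive s 1 (fun s => f (w + s *: v)) ('d f (w + s *: v) v).
Proof.
move=> df; have dv : derivable f (w + s *: v) v by exact: diff_derivable.
have E : (fun h : R => h^-1 *: (((fun s => f (w + s *: v)) \o shift s) h%:A - f (w + s *:
  v))) =
    (fun h => h^-1 *: ((f \o shift (w + s *: v)) (h *: v) - f (w + s *: v))).
  by apply/funext => h /=; rewrite [h%:A]mulr1 scalerDl addrCA.
by apply: DeriveDef; rewrite /derivable ?/derive E// -deriveE.
Qed.

(** Along the steps 1/(n+1) a derivative is the limit of a sequence, the form in which measurability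
    passes to it. *)
Lemma cvg_diff_quotient (f : V -> R) (w v : V) : differentiable f w ->
  n.+1%:R * (f (w + n.+1%:R^-1 *: v) - f w) @[n --> \oo] --> 'd f w v.
Proof.
move=> df; have dv : derivable f w v by exact: diff_derivable.
have /cvgr_dnbhsP := dv.
rewrite -/(derive f w v) deriveE// => /(_ (@harmonic R)) h.
have -> : (fun n => n.+1%:R * (f (w + n.+1%:R^-1 *: v) - f w)) =
   (fun n => (harmonic n)^-1 *: ((f \o shift w) (harmonic n *: v) - f w)).
  by apply/funext => n; rewrite /harmonic /= invrK [in RHS](addrC _ w).
apply: h; split; last exact: cvg_harmonic.
by move=> n; rewrite gt_eqF ?harmonic_gt0.
Qed.

End line_derivative.

Section caratheodory_functions.
Context d (T : measurableType d) (R : realType).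
Variable mu : {measure set T -> \bar R}.
Hypothesis cmu : measure_is_complete mu.
Variables (D : set T) (mD : measurable D).

(** Stands in for measurability of z with respect to a sigma-algebra on V: only the fibres of
    countably valued approximations have to be measurable, so V may be any topological space,
    products included. *)
Definition limit_of_countable (V : topologicalType) (z : T -> V) : Prop :=
  exists (K : countType) (k : nat -> T -> K) (c : nat -> K -> V),
    (forall n a, measurable (D `&` k n @^-1` [set a])) /\
    (forall x, D x -> c n (k n x) @[n --> \oo] --> z x).

Lemma cvg_floor_approx (t : R) :
  (Num.floor (n.+1%:R * t))%:~R / n.+1%:R @[n --> \oo] --> t.
Proof.
apply/subr_cvg0; apply: norm_cvg0; apply: (@squeeze_cvgr _ _ _ _ (cst 0) harmonic).
- apply: nearW => n /=; rewrite normr_ge0 /=.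
  have n0 : 0 < n.+1%:R :> R by [].
  rewrite -(ler_pM2l n0) mulfV ?gt_eqF// -{1}(gtr0_norm n0) -normrM mulrBr mulrCA mulfV
    ?gt_eqF// mulr1.
  have := floor_itv (n.+1%:R * t); rewrite intrD ler_norml; lra.
- exact: cvg_cst.
- exact: cvg_harmonic.
Qed.

Lemma measurable_floor_preimage (z : T -> R) n (a : int) : measurable_fun D z ->
  measurable (D `&` (fun x => Num.floor (n.+1%:R * z x)) @^-1` [set a]).
Proof.
move=> mz.
have -> : D `&` (fun x => Num.floor (n.+1%:R * z x)) @^-1` [set a] =
   D `&` (fun x => n.+1%:R * z x) @^-1` `[a%:~R, (a + 1)%:~R[%classic.
  apply/seteqP; split => x [Dx /= h]; split => //=.
    by rewrite in_itv /= -h floor_itv.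
  by apply: floor_def; move: h; rewrite in_itv.
have : measurable_fun D (fun x => n.+1%:R * z x) by exact: measurable_funM.
by apply.
Qed.

Lemma limit_of_countable_real (z : T -> R) : measurable_fun D z -> limit_of_countable z.
Proof.
move=> mz; exists int, (fun n x => Num.floor (n.+1%:R * z x)), (fun n a => a%:~R / n.+1%:R).
split=> [n a|x Dx]; [exact: measurable_floor_preimage|exact: cvg_floor_approx].
Qed.

Lemma limit_of_countable_row n (z : T -> 'rV[R]_n) :
  (forall j, measurable_fun D (fun x => z x 0 j)) -> limit_of_countable z.
Proof.
move=> mz.
exists 'rV[int]_n, (fun k x => \row_j Num.floor (k.+1%:R * z x 0 j)),
   (fun k (a : 'rV[int]_n) => \row_j ((a 0 j)%:~R / k.+1%:R)).
split=> [k a|x Dx]; last first.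
  by apply: cvg_row => j; under eq_fun do rewrite !mxE; exact: cvg_floor_approx.
have -> : D `&` (fun x => \row_j Num.floor (k.+1%:R * z x 0 j)) @^-1` [set a] =
  D `&` \bigcap_(j in [set: 'I_n]) (D `&` (fun x =>
    Num.floor (k.+1%:R * z x 0 j)) @^-1` [set a 0 j]).
  apply/seteqP; split => x [Dx /= h]; split => //.
    by move=> j _; split => //=; rewrite -h mxE.
  by apply/rowP => j; rewrite mxE; exact: (h j I).2.
apply: measurableI => //; apply: fin_bigcap_measurable => // j _.
exact: measurable_floor_preimage.
Qed.

Lemma limit_of_countable_pair (V W : topologicalType) (z : T -> V) (y : T -> W) :
  limit_of_countable z -> limit_of_countable y -> limit_of_countable (fun x => (z x, y x)).
Proof.
move=> [K [k [c [mk kz]]]] [L [l [e [ml ly]]]].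
exists (K * L)%type, (fun n x => (k n x, l n x)), (fun n a => (c n a.1, e n a.2)).
split=> [n [a b]|x Dx]; last by apply: cvg_pair; [exact: kz|exact: ly].
have -> : D `&` (fun x => (k n x, l n x)) @^-1` [set (a, b)] =
   (D `&` k n @^-1` [set a]) `&` (D `&` l n @^-1` [set b]).
  apply/seteqP; split => x /=; first by move=> [? [<- <-]].
  by move=> [[? <-] [? <-]].
exact: measurableI.
Qed.

(** On each of the countably many fibres of an approximation of z the second argument is constant,
    so the composite is measurable; continuity of f x carries this to the limit. *)
Lemma caratheodory_comp_measurable (V : topologicalType) (f : T -> V -> R) (z : T -> V) :
  (forall w, measurable_fun D (f ^~ w)) ->
  (\forall x \ae mu, D x -> continuous (f x)) ->
  limit_of_countable z -> measurable_fun D (fun x => f x (z x)).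
Proof.
move=> mf cf [K [k [c [mk kz]]]].
apply: (@ae_cvg_measurable _ _ _ _ cmu _ (fun n x => f x (c n (k n x)))) => [n|];
  last first.
  apply: filterS cf => x cfx Dx.
  exact: (cvg_comp _ _ (kz _ Dx) (cfx Dx (z x))).
move=> _ Y mY.
have -> : D `&` (fun x => f x (c n (k n x))) @^-1` Y =
  \bigcup_(a in [set: K]) ((D `&` k n @^-1` [set a]) `&` (D `&` (f ^~ (c n a)) @^-1` Y)).
  apply/seteqP; split => x /=; first by move=> [Dx Yx]; exists (k n x).
  by move=> [a _ [[Dx <-] [_ ?]]].
apply: countable_bigcupT_measurable => [|a]; first exact: countableP.
apply: measurableI => //; exact: mf.
Qed.

Lemma diff_measurable (V : normedModType R) (f : T -> V -> R) (v w : V) :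
  (forall w, measurable_fun D (f ^~ w)) ->
  (\forall x \ae mu, D x -> C1 (f x)) -> measurable_fun D (fun x => 'd (f x) w v).
Proof.
move=> mf cf; apply: (@ae_cvg_measurable _ _ _ _ cmu _
  (fun n x => n.+1%:R * (f x (w + n.+1%:R^-1 *: v) - f x w))) => [n|].
  apply: measurable_funM => //; exact: measurable_funB.
by apply: filterS cf => x /[apply] -[df _]; exact: cvg_diff_quotient.
Qed.

Lemma C1_continuous (V : normedModType R) (f : V -> R) : C1 f -> continuous f.
Proof. by move=> [df _] w; exact: differentiable_continuous. Qed.

Lemma diff_comp_measurable (V : normedModType R) (f : T -> V -> R) (v : V) (z : T -> V) :
  (forall w, measurable_fun D (f ^~ w)) ->
  (\forall x \ae mu, D x -> C1 (f x)) -> limit_of_countable z ->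
  measurable_fun D (fun x => 'd (f x) (z x) v).
Proof.
move=> mf cf lz; apply: (caratheodory_comp_measurable (f := fun x w => 'd (f x) w v)) => //.
  by move=> w; exact: diff_measurable.
by apply: filterS cf => x /[apply] -[_]; exact.
Qed.

(** The conditions on F' hold off one null set Z common to all r. Differentiation under the integral
    sign is applied on D minus Z, and the integrals over the two sets agree. *)
Lemma is_derive_Rintegral (F F' : R -> T -> R) (H : T -> R) (a b s : R) :
  (forall r, mu.-integrable D (EFin \o F r)) ->
  (forall r, measurable_fun D (F' r)) ->
  (\forall x \ae mu, D x -> forall r, r \in `]a, b[ ->
     is_derive r 1 (F ^~ x) (F' r x) /\ `|F' r x| <= H x) ->
  mu.-integrable D (EFin \o H) ->
  s \in `]a, b[ ->
  is_derive s 1 (fun r => \int[mu]_(x in D) F r x) (\int[mu]_(x in D) F' s x).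
Proof.
move=> iF mF' [Z [mZ Z0 subZ]] iH sab.
have mDZ : measurable (D `\` Z) by exact: measurableD.
have good x : (D `\` Z) x -> forall r, r \in `]a, b[ ->
     is_derive r 1 (F ^~ x) (F' r x) /\ `|F' r x| <= H x.
  by move=> [Dx Zx]; apply: contrapT => h; apply/Zx/subZ => /= /(_ Dx).
have sDZ g : mu.-integrable D (EFin \o g) -> mu.-integrable (D `\` Z) (EFin \o g).
  by apply: integrableS => //; exact: subDsetl.
have E g : mu.-integrable D (EFin \o g) -> \int[mu]_(x in D) g x = \int[mu]_(x in D `\`
  Z) g x.
  by move=> ig; rewrite /Rintegral (negligible_integral mZ mD ig Z0).
have pE r x : r \in `]a, b[ -> (D `\` Z) x -> partial1of2 F r x = F' r x.
  move=> rab DZx; rewrite partial1of2E.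
  by have [[_ ->] _] := good _ DZx _ rab.
have d1 r x : `]a, b[%classic r -> (D `\` Z) x -> derivable (F ^~ x) r 1.
  by move=> rab DZx; have [[]] := good _ DZx _ rab.
(* The dominating function must be nonnegative everywhere, hence the absolute value of H. *)
have iHn : mu.-integrable (D `\` Z) (EFin \o (fun x => `|H x|)).
  by apply: integrable_norm; exact: sDZ.
have bd r x : `]a, b[%classic r -> (D `\` Z) x -> `|partial1of2 F r x| <= `|H x|.
  move=> rab DZx; rewrite pE//; have [_ /le_trans] := good _ DZx _ rab; apply.
  exact: ler_norm.
have iFZ r : `]a, b[%classic r -> mu.-integrable (D `\` Z) (EFin \o F r) by move=> _;
  exact: sDZ.
have -> : (fun r => \int[mu]_(x in D) F r x) = (fun r => \int[mu]_(x in D `\` Z) F r x).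
  by apply/funext => r; exact: E.
have H0 x : 0 <= `|H x| by [].
apply: DeriveDef; first exact: (derivable_under_integral mDZ sab iFZ d1 H0 iHn bd).
rewrite -derive1E (differentiation_under_integral mDZ sab iFZ d1 H0 iHn bd).
transitivity (\int[mu]_(x in D `\` Z) F' s x).
  by apply: eq_Rintegral => x /set_mem DZx; exact: pE.
rewrite -E//; apply: (ae_le_integrable cmu mD (mF' s) iH).
exists Z; split => // x /= h; apply: contrapT => Zx; apply: h => Dx.
by have [] := good x (conj Dx Zx) _ sab.
Qed.

End caratheodory_functions.

(** * Finite sums of limits, a mean value theorem on [0, 1], powers and the Euclidean norm *)

Lemma cvg_sum_seq (R : realType) (I : Type) (r : seq I) (f : I -> nat -> R) (l : I -> R) :
  (forall i, f i @ \oo --> l i) ->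
  \sum_(i <- r) f i k @[k --> \oo] --> \sum_(i <- r) l i.
Proof.
move=> fl; elim: r => [|i r IH].
  by under eq_fun do rewrite big_nil; rewrite big_nil; exact: cvg_cst.
by under eq_fun do rewrite big_cons; rewrite big_cons; apply: cvgD.
Qed.

(** Derivatives on the larger open interval are two-sided at both ends of [0, 1], which yields
    continuity there. *)
Lemma mean_value01 (R : realType) (f df : R -> R) :
  (forall s : R, s \in `](-1), 2[ -> is_derive s 1 f (df s)) ->
  exists2 s, 0 < s < 1 & f 1 - f 0 = df s.
Proof.
move=> der; have l01 : (0 : R) < 1 by exact: ltr01.
have sub (s : R) : s \in `[0, 1] -> s \in `](-1), 2[ by rewrite !in_itv/=; lra.
have d1 (s : R) : s \in `]0, 1[ -> is_derive s 1 f (df s).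
  by move=> s01; apply: der; apply: sub; exact: subset_itv_oo_cc.
have c : {within `[0, 1], continuous f}.
  by apply: derivable_within_continuous => s /sub/der[].
have [s] := MVT l01 d1 c; rewrite in_itv/= subr0 mulr1 => s01 h.
by exists s.
Qed.

Section powers.
Variable R : realType.
Implicit Types (e r p : R).

Lemma powR_cvg0_seq (f : nat -> R) r : 0 < r -> (forall n, 0 <= f n) ->
  f n @[n --> \oo] --> 0 -> f n `^ r @[n --> \oo] --> 0.
Proof.
move=> r0 f0 /cvgr0Pnorm_lt h; apply/cvgr0Pnorm_le => e e0.
apply: filterS (h _ (powR_gt0 r^-1 e0)) => n;
  rewrite ger0_norm// ger0_norm ?powR_ge0// => /ltW fe.
have -> : e = (e `^ r^-1) `^ r by rewrite -powRrM mulVf ?gt_eqF// powRr1// ltW.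
by apply: ge0_ler_powR; rewrite ?nnegrE ?powR_ge0// ltW.
Qed.

(** With p' = p / (p - 1) one has e^(p - 1) = (e^p)^(1/p'), and r >= 1 absorbs the summand 1. Growth
    of order p - 1 in the gradient thus becomes a bound by Q^(1/p'), a function of L^{p'}. *)
Lemma powR_conj_le e r p : 1 < p -> 0 <= e -> 1 <= r -> e `^ p <= r ->
  1 + e `^ (p - 1) <= 2 * r `^ ((p / (p - 1))^-1).
Proof.
move=> p1 e0 r1 er.
have p0 : 0 < p by lra.
have c0 : 0 <= (p / (p - 1))^-1 by rewrite invr_ge0 divr_ge0; lra.
have -> : e `^ (p - 1) = (e `^ p) `^ ((p / (p - 1))^-1).
  by rewrite -powRrM; congr (_ `^ _); field; lra.
have : 1 `^ ((p / (p - 1))^-1) <= r `^ ((p / (p - 1))^-1) by rewrite ge0_ler_powR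
  ?nnegrE//; lra.
rewrite powR1 => h1.
have h2 : (e `^ p) `^ ((p / (p - 1))^-1) <= r `^ ((p / (p - 1))^-1).
  by rewrite ge0_ler_powR ?nnegrE ?powR_ge0//; lra.
lra.
Qed.

Lemma powR_conj_mul r p : 1 < p -> 0 < r -> r `^ ((p / (p - 1))^-1) * r `^ p^-1 = r.
Proof.
move=> p1 r0; rewrite -powRD; last by rewrite (gt_eqF r0) implybT.
have -> : (p / (p - 1))^-1 + p^-1 = 1 by field; lra.
by rewrite powRr1// ltW.
Qed.

Lemma le_powR_root e r p : 0 < p -> 0 <= e -> e `^ p <= r -> e <= r `^ p^-1.
Proof.
move=> p0 e0 er; have -> : e = (e `^ p) `^ p^-1 by rewrite -powRrM mulfV ?gt_eqF// powRr1.
have ? := le_trans (powR_ge0 e p) er.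
by rewrite ge0_ler_powR ?nnegrE ?powR_ge0// invr_ge0 ltW.
Qed.

End powers.

Section euclidean_norm.
Variables (R : realType) (n : nat).
Implicit Types (v w : 'rV[R]_n).

Lemma enorm_ge0 v : 0 <= enorm v. Proof. exact: sqrtr_ge0. Qed.

Lemma coord_le_enorm v j : `|v 0 j| <= enorm v.
Proof.
rewrite -sqrtr_sqr ler_wsqrtr// /dotv (bigD1 j)//= -expr2 lerDl.
by apply: sumr_ge0 => i _; rewrite -expr2 sqr_ge0.
Qed.

Lemma enorm0 : enorm (0 : 'rV[R]_n) = 0.
Proof. by rewrite /enorm /dotv big1 ?sqrtr0// => i _; rewrite mxE mul0r. Qed.

Lemma enormZ (c : R) v : enorm (c *: v) = `|c| * enorm v.
Proof.
rewrite /enorm /dotv -sqrtr_sqr -sqrtrM ?sqr_ge0//; congr Num.sqrt.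
by rewrite mulr_sumr; apply: eq_bigr => i _; rewrite !mxE expr2; ring.
Qed.

(** Coordinatewise 2ab <= a^2 + b^2 gives |v + w|^2 <= 2|v|^2 + 2|w|^2 <= (2 max(|v|, |w|))^2. A
    bound by the maximum is convenient for taking p-th powers. *)
Lemma enormD_max v w : enorm (v + w) <= 2 * Num.max (enorm v) (enorm w).
Proof.
have sq u : enorm u ^+ 2 = dotv u u.
  by rewrite sqr_sqrtr// sumr_ge0// => i _; rewrite -expr2 sqr_ge0.
have m0 : 0 <= Num.max (enorm v) (enorm w) by rewrite le_max enorm_ge0.
rewrite -ler_sqr ?nnegrE ?enorm_ge0 ?mulr_ge0//.
have h : dotv (v + w) (v + w) <= 2 * dotv v v + 2 * dotv w w.
  rewrite /dotv !mulr_sumr -big_split/=; apply: ler_sum => i _; rewrite !mxE.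
  by have := sqr_ge0 (v 0 i - w 0 i); nra.
rewrite -!sq in h; apply: le_trans h _.
rewrite exprMn; case: (leP (enorm v) (enorm w)) => [vw|/ltW wv].
  have : enorm v ^+ 2 <= enorm w ^+ 2 by rewrite ler_sqr ?nnegrE ?enorm_ge0.
  lra.
have : enorm w ^+ 2 <= enorm v ^+ 2 by rewrite ler_sqr ?nnegrE ?enorm_ge0.
lra.
Qed.

Lemma enormD_powR (p : R) v w : 0 <= p ->
  enorm (v + w) `^ p <= 2 `^ p * (enorm v `^ p + enorm w `^ p).
Proof.
move=> p0; have m0 : 0 <= Num.max (enorm v) (enorm w) by rewrite le_max enorm_ge0.
apply: le_trans (ge0_ler_powR p0 _ _ (enormD_max v w)) _;
  rewrite ?nnegrE ?enorm_ge0 ?mulr_ge0//.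
rewrite powRM// ler_wpM2l ?powR_ge0//.
by case: (leP (enorm v) (enorm w)) => _; [rewrite lerDr|rewrite lerDl]; exact: powR_ge0.
Qed.

Lemma cvg_enorm_powR (p : R) (f : nat -> 'rV[R]_n) l : 0 < p ->
  enorm (f k - l) `^ p @[k --> \oo] --> 0 -> f @ \oo --> l.
Proof.
move=> p0 h; apply: cvg_row => j; apply/subr_cvg0; apply: norm_cvg0.
have : (enorm (f k - l) `^ p) `^ p^-1 @[k --> \oo] --> 0.
  by apply: powR_cvg0_seq => //; [rewrite invr_gt0|move=> k; exact: powR_ge0].
move=> h0; apply: (@squeeze_cvgr _ _ _ _ (cst 0) _ _ _ _ _ h0); last exact: cvg_cst.
apply: nearW => k /=; rewrite normr_ge0/= -powRrM mulfV ?gt_eqF// powRr1 ?enorm_ge0//.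
by have := coord_le_enorm (f k - l) j; rewrite !mxE.
Qed.

Lemma measurable_enorm d (T : measurableType d) (D : set T) (g : T -> 'rV[R]_n) :
  (forall j, measurable_fun D (fun x => g x 0 j)) -> measurable_fun D (fun x =>
    enorm (g x)).
Proof.
move=> /(_ _) mg; apply: (@measurableT_comp _ _ _ _ _ _ (@Num.sqrt R)).
  by apply: continuous_measurable_fun; exact: sqrt_continuous.
apply: measurable_sum => j; exact: measurable_funM.
Qed.

Lemma measurable_enorm_powR d (T : measurableType d) (D : set T) (g : T ->
  'rV[R]_n) (p : R) :
  (forall j, measurable_fun D (fun x => g x 0 j)) ->
  measurable_fun D (fun x => enorm (g x) `^ p).
Proof.
move=> mg; apply: (@measurableT_comp _ _ _ _ _ _ (@powR R ^~ p)) => //.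
exact: measurable_enorm.
Qed.

End euclidean_norm.

(** * The functional on a complete measure space *)

Section lebesgue_norms.
Context d (T : measurableType d) (R : realType).
Variable mu : {measure set T -> \bar R}.
Variables (D : set T) (mD : measurable D).

(** Restriction to D is done as in [norm_Lp], so that the norms on X are instances by conversion. *)
Definition Lp_norm (p : R) (f : T -> R) : \bar R :=
  'N[mu]_p%:E[EFin \o (f \_ D)]%E.

(** Outside D the restriction takes the default value 0, and 0 ^ p = 0 because p != 0. *)
Lemma integral_Lp_norm (p : R) (f : T -> R) : p != 0 ->
  (\int[mu]_(x in D) (`|f x| `^ p)%:E = Lp_norm p f `^ p)%E.
Proof.
move=> p0; rewrite /Lp_norm (poweR_Lnorm _ _ p0) [LHS]integral_mkcond.
apply: eq_integral => x _.
rewrite /= !patchE; case: ifPn => // _.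
by rewrite /point/= normr0 powR0.
Qed.

Lemma Lp_normE (p : R) (f : T -> R) : p != 0 ->
  (Lp_norm p f = (\int[mu]_(x in D) (`|f x| `^ p)%:E) `^ p^-1)%E.
Proof.
move=> p0; rewrite integral_Lp_norm// -poweRrM mulfV// poweRe1//.
exact: Lnorm_ge0.
Qed.

Lemma hoelder_on (f g : T -> R) (p q : R) :
  measurable_fun D f -> measurable_fun D g -> 0 < p -> 0 < q -> p^-1 + q^-1 = 1 ->
  (\int[mu]_(x in D) `|f x * g x|%:E <= Lp_norm p f * Lp_norm q g)%E.
Proof.
move=> mf mg p0 q0 pq; apply: le_trans (hoelder mu _ _ p0 q0 pq).
- rewrite Lnorm1 integral_mkcond; under eq_integral => x _.
    rewrite (_ : _ x = `|((EFin \o (f \_ D \* g \_ D)%R) x)|%E); first over.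
    by rewrite /= !patchE; case: ifPn => //; rewrite /point/= mul0r normr0.
  by [].
- by apply/(measurable_restrictT _ mD).
- by apply/(measurable_restrictT _ mD).
Qed.

Lemma le_Lp_norm (p : R) (f g : T -> R) : 0 < p ->
  measurable_fun D f -> measurable_fun D g -> (forall x, `|f x| <= `|g x|) ->
  (Lp_norm p f <= Lp_norm p g)%E.
Proof.
move=> p0 mf mg fg; have pn0 : p != 0 by rewrite gt_eqF.
rewrite (Lp_normE f pn0) (Lp_normE g pn0).
have m (h : T -> R) : measurable_fun D h -> measurable_fun D (fun x => (`|h x| `^ p)%:E).
  move=> mh; apply/measurable_EFinP.
  apply: (@measurableT_comp _ _ _ _ _ _ (@powR R ^~ p)) => //; exact: measurableT_comp.
have i0 (h : T -> R) : (0 <= \int[mu]_(x in D) (`|h x| `^ p)%:E)%E.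
  by apply: integral_ge0 => x _; rewrite lee_fin powR_ge0.
apply: gt0_ler_poweR; [by rewrite invr_ge0 ltW|by rewrite in_itv/= leey i0|by rewrite
  in_itv/= leey i0|].
apply: ge0_le_integral => //; do ?[exact: m].
by move=> x _; rewrite lee_fin ge0_ler_powR ?nnegrE// ltW.
Qed.

Lemma cvg_Lp_norm0 (p : R) (f : nat -> T -> R) : 0 < p ->
  (\int[mu]_(x in D) (`|f n x| `^ p)%:E)%E @[n --> \oo] --> 0%E ->
  Lp_norm p (f n) @[n --> \oo] --> 0%E.
Proof.
move=> p0 /fine_cvgP[hf h]; apply/fine_cvgP.
have E n : Lp_norm p (f n) = ((\int[mu]_(x in D) (`|f n x| `^ p)%:E) `^ p^-1)%E.
  by rewrite Lp_normE ?(gt_eqF p0).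
split.
  by apply: filterS hf => n hn; rewrite E fin_num_poweR.
have -> : fine \o (fun n => Lp_norm p (f n)) =
    (fun n => (fine (\int[mu]_(x in D) (`|f n x| `^ p)%:E)%E) `^ p^-1).
  by apply/funext => n /=; rewrite E fine_poweR.
apply: powR_cvg0_seq => //; first by rewrite invr_gt0.
by move=> n; rewrite fine_ge0// integral_ge0// => x _; rewrite lee_fin powR_ge0.
Qed.

Lemma Lp_norm_lty (p : R) (f H : T -> R) : 0 < p ->
  measurable_fun D f -> mu.-integrable D (EFin \o H) ->
  (\forall x \ae mu, D x -> `|f x| `^ p <= H x) -> (Lp_norm p f < +oo)%E.
Proof.
move=> p0 mf iH fH; rewrite Lp_normE; last by rewrite gt_eqF.
apply: poweR_lty.
apply: le_lt_trans (integrableP _ _ _ iH).2.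
apply: ae_ge0_le_integral => //.
- apply/measurable_EFinP.
  apply: (@measurableT_comp _ _ _ _ _ _ (@powR R ^~ p)) => //; exact: measurableT_comp.
- by apply: measurableT_comp => //; exact: measurable_int iH.
apply: filterS fH => x /[apply] h /=; rewrite lee_fin.
by apply: le_trans h _; exact: ler_norm.
Qed.

End lebesgue_norms.

Section functional.
Context d (T : measurableType d) (R : realType).
Variable mu : {measure set T -> \bar R}.
Hypothesis cmu : measure_is_complete mu.
Variables (D : set T) (mD : measurable D).
Hypothesis muD : (mu D < +oo)%E.
Variables (N m : nat) (p : 'I_m -> R).
Hypothesis p1 : forall i, 1 < p i.
Local Notation V := (R^o * 'rV[R]_N)%type.
Variables (a : 'I_m -> T -> V -> R) (G : T -> 'rV[R]_m -> R).
Hypotheses (ma : forall i w, measurable_fun D (a i ^~ w))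
  (ca : forall i, \forall x \ae mu, D x -> C1 (a i x))
  (mG : forall w, measurable_fun D (G ^~ w))
  (cG : \forall x \ae mu, D x -> C1 (G x)).
(** [ga] and [gG] keep what the growth conditions give for values bounded by M; [growth_A_bound] and
    [growth_G_bound] derive them. *)
Hypothesis ga : forall i (M : R), exists2 C : R, 0 <= C &
  \forall x \ae mu, D x -> forall (t : R) (xi : 'rV[R]_N), `|t| <= M ->
  [/\ `|a i x (t, xi)| <= C * (1 + enorm xi `^ p i),
      `|'d (a i x) ((t, xi) : V) (1, 0)| <= C * (1 + enorm xi `^ p i) &
      forall j : 'I_N, `|'d (a i x) ((t, xi) : V) (0, delta_mx 0 j)| <=
        C * (1 + enorm xi `^ (p i - 1)) ].
Hypothesis gG : forall M : R, exists2 C : R, 0 <= C &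
  \forall x \ae mu, D x -> forall w : 'rV[R]_m, (forall i, `|w 0 i| <= M) ->
  `|G x w| <= C /\ forall i, `|'d (G x) w (delta_mx 0 i)| <= C.

Definition state : Type := 'I_m -> (T -> R) * (T -> 'rV[R]_N).

Implicit Types (u v w : state).

Definition jet u i x : V := ((u i).1 x, (u i).2 x).
Definition svals u x : 'rV[R]_m := \row_i (u i).1 x.
Definition conj_exp i := p i / (p i - 1).
Definition dxi u i j x := 'd (a i x) (jet u i x) (0, delta_mx 0 j).
Definition dt u i x := 'd (a i x) (jet u i x) (1, 0).
Definition dG u i x := 'd (G x) (svals u x) (delta_mx 0 i).

Definition measurable_state u := forall i, measurable_fun D (u i).1 /\
  forall j, measurable_fun D (fun x => (u i).2 x 0 j).
Definition envelope (Q : T -> R) := mu.-integrable D (EFin \o Q) /\ forall x, 1 <= Q x.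
Definition bounded_at (M Q : R) u x :=
  forall i, `|(u i).1 x| <= M /\ enorm ((u i).2 x) `^ p i <= Q.
Definition in_class (M : R) (Q : T -> R) u := measurable_state u /\
  \forall x \ae mu, D x -> bounded_at M (Q x) u x.

(** The state is quantified after the point x, so the exceptional null set does not depend on it;
    [action_line_derive] relies on this for the uncountably many states of a segment. *)
Lemma growth_at (M : R) : exists2 C : R, 0 <= C & \forall x \ae mu, D x ->
  forall u (Q : R), 1 <= Q -> bounded_at M Q u x ->
  [/\ `|G x (svals u x)| <= C * Q, forall i, `|dG u i x| <= C * Q &
   forall i, [/\ `|a i x (jet u i x)| <= C * Q, `|dt u i x| <= C * Q &
      forall j, `|dxi u i j x| <= C * Q `^ (conj_exp i)^-1]].
Proof.
have [CG CG0 hG] := gG M.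
have /choice[Ca Cah] i : exists C : R, 0 <= C /\ \forall x \ae mu, D x ->
  forall (t : R) (xi : 'rV[R]_N), `|t| <= M ->
  [/\ `|a i x (t, xi)| <= C * (1 + enorm xi `^ p i),
      `|'d (a i x) ((t, xi) : V) (1, 0)| <= C * (1 + enorm xi `^ p i) &
      forall j : 'I_N, `|'d (a i x) ((t, xi) : V) (0, delta_mx 0 j)| <=
        C * (1 + enorm xi `^ (p i - 1)) ].
  by have [C C0 h] := ga i M; exists C.
have Ca0 i : 0 <= Ca i by have [] := Cah i.
have sCa0 : 0 <= \sum_i Ca i by exact: sumr_ge0.
have le1 i : Ca i <= CG + \sum_i Ca i.
  by rewrite (bigD1 i)//= addrCA lerDl addr_ge0// sumr_ge0.
(* The factor 2 comes from 1 + |xi|^p <= 2 Q, as Q >= 1; the sum makes one constant serve G and all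
   i. *)
exists (2 * (CG + \sum_i Ca i)); first by lra.
have := ae_ord (fun i => (Cah i).2); apply: filterS2 hG => x hG ha Dx u Q Q1 uQ.
have uM i : `|svals u x 0 i| <= M by rewrite mxE; have [] := uQ i.
have [h1 h2] := hG Dx _ uM.
have CGQ : CG <= 2 * (CG + \sum_i Ca i) * Q by nra.
split => [|i|i].
- exact: le_trans h1 _.
- exact: le_trans (h2 i) _.
have [ut uxi] := uQ i; have [k1 k2 k3] := ha Dx i _ ((u i).2 x) ut.
have le2 : Ca i * (1 + enorm ((u i).2 x) `^ p i) <= 2 * (CG + \sum_i Ca i) * Q.
  rewrite -mulrA mulrCA; apply: ler_pM => //; last by lra.
  by rewrite addr_ge0// powR_ge0.
split => [||j]; [exact: le_trans k1 _|exact: le_trans k2 _|apply: le_trans (k3 j) _].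
rewrite -mulrA mulrCA; apply: ler_pM => //; first by rewrite addr_ge0// powR_ge0.
by apply: powR_conj_le => //; exact: enorm_ge0.
Qed.


(** * Measurability, pointwise limits and class bounds of the coefficients *)

Lemma jet_limit u i : measurable_state u -> limit_of_countable D (jet u i).
Proof.
move=> su; have [m1 m2] := su i.
apply: (@limit_of_countable_pair _ _ D R^o _ (u i).1 (u i).2).
  exact: limit_of_countable_real.
exact: limit_of_countable_row.
Qed.

Lemma svals_limit u : measurable_state u -> limit_of_countable D (svals u).
Proof.
move=> su; apply: limit_of_countable_row => // i.
by under eq_fun do rewrite mxE; exact: (su i).1.
Qed.

Section measurability.
Variables (u : state) (su : measurable_state u).

Lemma measurable_a i : measurable_fun D (fun x => a i x (jet u i x)).
Proof.
apply: (caratheodory_comp_measurable cmu mD (ma i)); last exact: jet_limit.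
by apply: filterS (ca i) => x /[apply]; exact: C1_continuous.
Qed.

Lemma measurable_G : measurable_fun D (fun x => G x (svals u x)).
Proof.
apply: (caratheodory_comp_measurable cmu mD mG); last exact: svals_limit.
by apply: filterS cG => x /[apply]; exact: C1_continuous.
Qed.

Lemma measurable_dxi i j : measurable_fun D (dxi u i j).
Proof. by apply: (diff_comp_measurable cmu mD) => //; exact: jet_limit. Qed.

Lemma measurable_dt i : measurable_fun D (dt u i).
Proof. by apply: (diff_comp_measurable cmu mD) => //; exact: jet_limit. Qed.

Lemma measurable_dG i : measurable_fun D (dG u i).
Proof. by apply: (diff_comp_measurable cmu mD) => //; exact: svals_limit. Qed.

End measurability.

Section pointwise_convergence.
Variables (U : nat -> state) (u : state).
Hypothesis Uu : \forall x \ae mu, D x -> forall i,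
  (U k i).1 x @[k --> \oo] --> (u i).1 x /\ (U k i).2 x @[k --> \oo] --> (u i).2 x.

Lemma cvg_nemytskii : \forall x \ae mu, D x ->
  [/\ G x (svals (U k) x) @[k --> \oo] --> G x (svals u x),
     forall i, dG (U k) i x @[k --> \oo] --> dG u i x &
  forall i, [/\ a i x (jet (U k) i x) @[k --> \oo] --> a i x (jet u i x),
    dt (U k) i x @[k --> \oo] --> dt u i x &
    forall j, dxi (U k) i j x @[k --> \oo] --> dxi u i j x]].
Proof.
have := ae_ord ca; apply: filterS3 Uu cG => x Uux cGx cax Dx.
have [dGx cdG] := cGx Dx.
have cs : svals (U k) x @[k --> \oo] --> svals u x.
  by apply: cvg_row => j; under eq_fun do rewrite mxE; rewrite mxE; exact: (Uux Dx j).1.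
have cj i : jet (U k) i x @[k --> \oo] --> jet u i x.
  have [h1 h2] := Uux Dx i; exact: (cvg_pair h1 h2).
split=> [|i|i].
- refine (cvg_comp (fun k => svals (U k) x) (G x) cs _); exact: (C1_continuous (cGx Dx)).
- rewrite /dG; refine (@cvg_comp nat 'rV[R]_m R (fun k => svals (U k) x) (fun y =>
    'd (G x) y (delta_mx 0 i)) _ _ _ cs _); exact: (cdG _ (svals u x)).
have [_ cda] := cax Dx i.
split=> [||j].
- refine (cvg_comp (fun k => jet (U k) i x) (a i x) (cj i) _);
    exact: (C1_continuous (cax Dx i)).
- rewrite /dt /dxi; refine (@cvg_comp nat V R (fun k => jet (U k) i x) (fun y =>
    'd (a i x) y (1, 0)) _ _ _ (cj i) _); exact: (cda _ (jet u i x)).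
- rewrite /dt /dxi; refine (@cvg_comp nat V R (fun k => jet (U k) i x) (fun y =>
    'd (a i x) y (0, delta_mx 0 j)) _ _ _ (cj i) _); exact: (cda _ (jet u i x)).
Qed.

End pointwise_convergence.

Section class_estimates.
Variables (M : R) (Q : T -> R) (envQ : envelope Q).

Lemma class_estimates : exists2 C : R, 0 <= C & forall u, in_class M Q u ->
  \forall x \ae mu, D x -> [/\ `|G x (svals u x)| <= C * Q x, forall i,
    `|dG u i x| <= C * Q x &
   forall i, [/\ `|a i x (jet u i x)| <= C * Q x, `|dt u i x| <= C * Q x &
      forall j, `|dxi u i j x| <= C * Q x `^ (conj_exp i)^-1]].
Proof.
have [C C0 h] := growth_at M; exists C => // u [_ uQ].
by apply: filterS2 h uQ => x + + Dx => /(_ Dx) + /(_ Dx); apply; exact: envQ.2.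
Qed.

Lemma integrable_envelopeZ (C : R) : mu.-integrable D (EFin \o (fun x => C * Q x)).
Proof.
have [iQ _] := envQ.
rewrite (_ : _ \o _ = (fun x => C%:E * (EFin \o Q) x)%E); first exact: integrableZl.
by apply/funext => x; rewrite /= EFinM.
Qed.

Lemma integrable_le (C : R) (f : T -> R) : measurable_fun D f ->
  (\forall x \ae mu, D x -> `|f x| <= C * Q x) -> mu.-integrable D (EFin \o f).
Proof. by move=> mf; apply: (ae_le_integrable cmu mD mf); exact: integrable_envelopeZ. Qed.

Lemma integrable_class u : in_class M Q u ->
  [/\ mu.-integrable D (EFin \o (fun x => G x (svals u x))),
      forall i, mu.-integrable D (EFin \o dG u i) &
    forall i, mu.-integrable D (EFin \o (fun x => a i x (jet u i x))) /\
      mu.-integrable D (EFin \o dt u i)].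
Proof.
move=> uQ; have [C C0 /(_ _ uQ) h] := class_estimates; have [su _] := uQ.
split=> [|i|i]; last split.
- apply: (@integrable_le C); first exact: measurable_G.
  by apply: filterS h => x /[apply] -[].
- apply: (@integrable_le C); first exact: measurable_dG.
  by apply: filterS h => x /[apply] -[].
- apply: (@integrable_le C); first exact: measurable_a.
  by apply: filterS h => x /[apply] -[_ _ /(_ i)[]].
- apply: (@integrable_le C); first exact: measurable_dt.
  by apply: filterS h => x /[apply] -[_ _ /(_ i)[]].
Qed.

End class_estimates.

Definition action u : R := \sum_(i < m) \int[mu]_(x in D) a i x (jet u i x)
  - \int[mu]_(x in D) G x (svals u x).

Definition daction u v : R := \sum_(i < m)
  (\int[mu]_(x in D) (\sum_j dxi u i j x * (v i).2 x 0 j)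
   + \int[mu]_(x in D) (dt u i x * (v i).1 x)
   - \int[mu]_(x in D) (dG u i x * (v i).1 x)).

(** The l^1 norm is chosen because, with |xi_j| <= |xi|, its product with |xi| bounds the scalar
    product with xi directly. *)
Definition xi_gap w u i x : R := \sum_j `|dxi w i j x - dxi u i j x|.
Definition t_gap w u i x : R := (dt w i x - dG w i x) - (dt u i x - dG u i x).

(* Dominates the dual norm of [daction w - daction u]. *)
Definition gap w u : \bar R :=
  (\sum_(i < m) (Lp_norm mu D (conj_exp i) (xi_gap w u i) +
                 \int[mu]_(x in D) `|t_gap w u i x|%:E))%E.

Lemma conj_exp_gt0 i : 0 < conj_exp i.
Proof. by have := p1 i; rewrite /conj_exp => ?; rewrite divr_gt0; lra. Qed.

Lemma measurable_xi_gap w u i : measurable_state w -> measurable_state u ->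
  measurable_fun D (xi_gap w u i).
Proof.
move=> mw su; apply: measurable_sum => j; apply: measurableT_comp => //.
by apply: measurable_funB; exact: measurable_dxi.
Qed.

Section dominated_sequences.
Variables (M : R) (Q : T -> R) (envQ : envelope Q).
Variables (U : nat -> state) (u : state).
Hypotheses (UQ : forall k, in_class M Q (U k)) (uQ : in_class M Q u).
Hypothesis Uu : \forall x \ae mu, D x -> forall i,
  (U k i).1 x @[k --> \oo] --> (u i).1 x /\ (U k i).2 x @[k --> \oo] --> (u i).2 x.

Lemma dominated_cvg_action : action (U k) @[k --> \oo] --> action u.
Proof.
have [C C0 hC] := class_estimates M envQ.
have hU := ae_foralln (fun k => hC _ (UQ k)).
have cU := cvg_nemytskii Uu.
have iQ := integrable_envelopeZ envQ C.
apply: cvgB.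
  apply: cvg_sum_seq => i.
  have [] // := @dominated_Rintegral _ _ _ mu cmu D mD
    (fun k x => a i x (jet (U k) i x)) (fun x => a i x (jet u i x)) _ _ _ iQ _.
  - by move=> k; apply: measurable_a; exact: (UQ k).1.
  - by apply: filterS cU => x /[apply] -[_ _ /(_ i)[]].
  - by apply: filterS hU => x hx Dx k; have [_ _ /(_ i)[]] := hx k Dx.
have [] // := @dominated_Rintegral _ _ _ mu cmu D mD
  (fun k x => G x (svals (U k) x)) (fun x => G x (svals u x)) _ _ _ iQ _.
- by move=> k; apply: measurable_G; exact: (UQ k).1.
- by apply: filterS cU => x /[apply] -[].
- by apply: filterS hU => x hx Dx k; have [] := hx k Dx.
Qed.

(** The p'-th powers of [xi_gap] tend to 0 in L^1 by domination, which is convergence in L^{p'}; the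
    coefficient of the values is treated in L^1 itself. *)
Lemma dominated_cvg_gap : gap (U k) u @[k --> \oo] --> 0%E.
Proof.
have [C C0 hC] := class_estimates M envQ.
have hU := ae_foralln (fun k => hC _ (UQ k)).
have hu := hC _ uQ.
have cU := cvg_nemytskii Uu.
have E0 : (\sum_(i < m) 0 = 0 :> \bar R)%E by rewrite big1.
rewrite -E0.
apply: cvg_nnesum => i _.
  by apply: nearW => k; rewrite adde_ge0 ?Lnorm_ge0// integral_ge0.
rewrite -[0%E]adde0; apply: cvgeD => //.
- apply: cvg_Lp_norm0; first exact: conj_exp_gt0.
  (* There are N components, each a difference of two coefficients bounded by C Q^(1/p'). Hence
     [xi_gap] is at most K Q^(1/p'), and its p'-th power at most K^p' Q. *)
  pose K := 2 * C * N%:R.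
  have K0 : 0 <= K by rewrite !mulr_ge0.
  have gap0 k x : 0 <= xi_gap (U k) u i x by exact: sumr_ge0.
  have iQ := integrable_envelopeZ envQ (K `^ conj_exp i).
  have [] := @dominated_Rintegral _ _ _ mu cmu D mD
    (fun k x => xi_gap (U k) u i x `^ conj_exp i) (fun=> 0) _ _ _ iQ _.
  + move=> k; apply: (@measurableT_comp _ _ _ _ _ _ (@powR R ^~ _)) => //.
    by apply: measurable_xi_gap; [exact: (UQ k).1|exact: uQ.1].
  + apply: filterS cU => x /[apply] -[_ _ /(_ i)[_ _ cxi]].
    apply: powR_cvg0_seq; [exact: conj_exp_gt0|by move=> k; exact: gap0|].
    have E1 : \sum_(j < N) 0 = 0 :> R by rewrite big1.
    rewrite -E1.
    apply: cvg_sum_seq => j; rewrite -(normr0 R).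
    by apply: cvg_norm; apply/subr_cvg0; exact: cxi.
  + apply: filterS2 hU hu => x hUx hux Dx k.
    rewrite ger0_norm ?powR_ge0//.
    have -> : K `^ conj_exp i * Q x = (K * Q x `^ (conj_exp i)^-1) `^ conj_exp i.
      rewrite powRM ?powR_ge0// -powRrM mulVf ?gt_eqF ?conj_exp_gt0// powRr1//.
      by have := envQ.2 x; lra.
    apply: ge0_ler_powR; [exact: ltW (conj_exp_gt0 i)|by rewrite nnegrE gap0|
      by rewrite nnegrE mulr_ge0 ?powR_ge0|].
    have [_ _ /(_ i)[_ _ h1]] := hUx k Dx; have [_ _ /(_ i)[_ _ h2]] := hux Dx.
    apply: le_trans (ler_sum _ (fun j _ => ler_normB _ _)) _.
    apply: (@le_trans _ _ (\sum_(j < N) 2 * (C * Q x `^ (conj_exp i)^-1))).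
      by apply: ler_sum => j _; rewrite mulr_natl mulr2n; exact: lerD.
    rewrite sumr_const card_ord -mulr_natr /K le_eqVlt; apply/orP; left; apply/eqP; ring.
  move=> _ + _; under eq_fun do under eq_integral do rewrite subr0.
  move=> h; under eq_fun do under eq_integral do rewrite ger0_norm//.
  by under eq_fun do under eq_integral do rewrite -(ger0_norm (powR_ge0 _ _)).
- have iQ := integrable_envelopeZ envQ (2 * C).
  have [] := @dominated_Rintegral _ _ _ mu cmu D mD
    (fun k x => dt (U k) i x - dG (U k) i x) (fun x => dt u i x - dG u i x) _ _ _ iQ _.
  + by move=> k; apply: measurable_funB; [apply: measurable_dt|apply: measurable_dG];
      exact: (UQ k).1.
  + apply: filterS cU => x /[apply] -[_ /(_ i) c1 /(_ i)[_ c2 _]]; exact: cvgB.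
  + apply: filterS hU => x hx Dx k; have [_ /(_ i) h1 /(_ i)[_ h2 _]] := hx k Dx.
    apply: le_trans (ler_normB _ _) _; apply: le_trans (lerD h2 h1) _.
    by rewrite -mulrA mulr_natl mulr2n.
  by [].
Qed.

End dominated_sequences.

(** * Hoelder estimates for the differential, seen as a pairing of coefficients with a direction *)

Definition pairing (f : 'I_m -> 'I_N -> T -> R) (b : 'I_m -> T -> R) v : R :=
  \sum_(i < m) (\int[mu]_(x in D) (\sum_j f i j x * (v i).2 x 0 j)
                + \int[mu]_(x in D) (b i x * (v i).1 x)).

(** For differences of coefficients this is [gap] by conversion, for the coefficients of one state
    it is [daction_norm]; [pairing_le] therefore yields both estimates. *)
Definition pairing_norm (f : 'I_m -> 'I_N -> T -> R) (b : 'I_m -> T -> R) : \bar R :=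
  (\sum_(i < m) (Lp_norm mu D (conj_exp i) (fun x => \sum_j `|f i j x|)%R +
                 \int[mu]_(x in D) `|b i x|%:E))%E.

(** Since 1/p' + 1/p = 1, a coefficient of order q^(1/p') against a gradient of order q^(1/p) is of
    order q. *)
Lemma pairing_pointwise (C M q t b : R) i (f : 'I_N -> R) (xi : 'rV[R]_N) :
  1 <= q -> enorm xi `^ p i <= q -> `|t| <= M ->
  (forall j, `|f j| <= C * q `^ (conj_exp i)^-1) -> `|b| <= C * q ->
  `|\sum_j f j * xi 0 j| <= N%:R * C * q /\ `|b * t| <= C * M * q.
Proof.
move=> q1 xiq tM fq bq; split; last by rewrite normrM mulrAC; exact: ler_pM.
apply: le_trans (ler_norm_sum _ _ _) _.
apply: (@le_trans _ _ (\sum_(j < N) C * q)).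
  apply: ler_sum => j _; rewrite normrM.
  have q0 : 0 < q by lra.
  rewrite -(powR_conj_mul (p1 i) q0) -/(conj_exp i) mulrA; apply: ler_pM => //.
  apply: le_trans (coord_le_enorm _ _) _; apply: le_powR_root => //; last exact: enorm_ge0.
  by have := p1 i; lra.
by rewrite sumr_const card_ord -[leLHS]mulr_natl mulrA.
Qed.

Section pairings.
Variables (M : R) (Q : T -> R) (envQ : envelope Q).

Definition dominated_field (C : R) (f : 'I_m -> 'I_N -> T -> R) (b : 'I_m -> T -> R) :=
  [/\ forall i j, measurable_fun D (f i j), forall i, measurable_fun D (b i) &
   \forall x \ae mu, D x -> forall i,
     (forall j, `|f i j x| <= C * Q x `^ (conj_exp i)^-1) /\ `|b i x| <= C * Q x].

Variables (C : R) (f : 'I_m -> 'I_N -> T -> R) (b : 'I_m -> T -> R).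
Hypotheses (C0 : 0 <= C) (fb : dominated_field C f b).

Lemma pairing_integrable v i : in_class M Q v ->
  [/\ mu.-integrable D (EFin \o (fun x => \sum_j f i j x * (v i).2 x 0 j)),
      mu.-integrable D (EFin \o (fun x => b i x * (v i).1 x)) &
      mu.-integrable D (EFin \o b i)].
Proof.
move=> [mv vQ]; have [mf mb fbQ] := fb; have [mv1 mv2] := mv i.
split.
- apply: (@integrable_le _ envQ (N%:R * C)).
    by apply: measurable_sum => j; exact: measurable_funM.
  apply: filterS2 fbQ vQ => x hf hv Dx; have [hfi hbi] := hf Dx i;
    have [hv1 hv2] := hv Dx i.
  by have [] := pairing_pointwise (envQ.2 x) hv2 hv1 hfi hbi.
- apply: (@integrable_le _ envQ (C * M)); first exact: measurable_funM.
  apply: filterS2 fbQ vQ => x hf hv Dx; have [hfi hbi] := hf Dx i;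
    have [hv1 hv2] := hv Dx i.
  by have [] := pairing_pointwise (envQ.2 x) hv2 hv1 hfi hbi.
- apply: (@integrable_le _ envQ C) => //.
  by apply: filterS fbQ => x /[apply] /(_ i)[].
Qed.

Lemma pairing_norm_lty : (pairing_norm f b < +oo)%E.
Proof.
have [mf mb fbQ] := fb; apply: lte_sum_pinfty => i _; rewrite lte_add_pinfty//.
  apply: (@Lp_norm_lty _ _ _ _ _ _ _ _ (fun x => (N%:R * C) `^ conj_exp i * Q x)).
  - exact: mD.
  - exact: conj_exp_gt0.
  - by apply: measurable_sum => j; exact: measurableT_comp.
  - exact: integrable_envelopeZ.
  apply: filterS fbQ => x /[apply] /(_ i)[hfi _].
  have -> : (N%:R * C) `^ conj_exp i * Q x = ((N%:R * C) * Q x `^ (conj_exp i)^-1) `^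
    conj_exp i.
    rewrite [RHS]powRM ?mulr_ge0 ?powR_ge0// -powRrM mulVf ?gt_eqF ?conj_exp_gt0// powRr1//.
    by have := envQ.2 x; lra.
  apply: ge0_ler_powR; [exact: ltW (conj_exp_gt0 i)|by rewrite nnegrE|
    by rewrite nnegrE !mulr_ge0 ?powR_ge0|].
  rewrite ger0_norm ?sumr_ge0//.
  apply: le_trans (ler_sum _ (fun j _ => hfi j)) _.
  by rewrite sumr_const card_ord -[leLHS]mulr_natl mulrA.
have ib : mu.-integrable D (EFin \o b i).
  apply: (@integrable_le _ envQ C) => //.
  by apply: filterS fbQ => x /[apply] /(_ i)[].
by have /integrableP[] := ib.
Qed.

(** Hoelder's inequality with p' and p for the gradients, L^1 against L^oo for the values. The class
    of v gives integrability of the products, while k alone fixes the size of the bound. *)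
Lemma pairing_le v k : 0 <= k -> in_class M Q v ->
  (forall i, Lp_norm mu D (p i) (fun x => enorm ((v i).2 x)) <= k%:E)%E ->
  (forall i, \forall x \ae mu, D x -> `|(v i).1 x| <= k) ->
  (`|pairing f b v|%:E <= pairing_norm f b * k%:E)%E.
Proof.
move=> k0 vQ vk1 vk2; have [mv _] := vQ; have [mf mb _] := fb.
rewrite ge0_sume_distrl; last first.
  by move=> i _; rewrite adde_ge0 ?Lnorm_ge0// integral_ge0.
apply: le_trans (_ : (\sum_(i < m) `|\int[mu]_(x in D) (\sum_j f i j x * (v i).2 x 0 j)
                + \int[mu]_(x in D) (b i x * (v i).1 x)|%:E <= _)%E).
  by rewrite sumEFin lee_fin; exact: ler_norm_sum.
apply: lee_sum => i _; have [i1 i2 i3] := pairing_integrable i vQ.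
rewrite ge0_muleDl ?Lnorm_ge0//; last by rewrite integral_ge0.
apply: le_trans (_ : (`|_|%:E + `|_|%:E <= _)%E); first by rewrite -EFinD lee_fin;
  exact: ler_normD.
have mS : measurable_fun D (fun x => \sum_j `|f i j x|).
  by apply: measurable_sum => j; exact: measurableT_comp.
have mE := measurable_enorm (mv i).2.
have pi1 := p1 i.
apply: leeD.
  rewrite EFin_normr_Rintegral//.
  apply: le_trans (le_abse_integral mu mD (measurable_int _ i1)) _.
  apply: (@le_trans _ _ (Lp_norm mu D (conj_exp i) (fun x => \sum_j `|f i j x|)%R *
    Lp_norm mu D (p i) (fun x => enorm ((v i).2 x)))%E); last first.
    by apply: lee_pmul => //; exact: Lnorm_ge0.
  have c1 : (conj_exp i)^-1 + (p i)^-1 = 1.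
    by rewrite /conj_exp; field; rewrite subr_eq0 !gt_eqF//; lra.
  have pi0 : 0 < p i by lra.
  apply: (le_trans _ (hoelder_on mu mD mS mE (conj_exp_gt0 i) pi0 c1)).
  apply: ge0_le_integral => //.
  - by apply: measurableT_comp => //; exact: measurable_int i1.
  - by apply/measurable_EFinP; apply: measurableT_comp => //; exact: measurable_funM.
  move=> x _ /=; rewrite lee_fin mulr_suml.
  apply: le_trans (ler_norm_sum _ _ _) _; apply: (le_trans _ (ler_norm _)).
  by apply: ler_sum => j _; rewrite normrM ler_wpM2l// coord_le_enorm.
rewrite EFin_normr_Rintegral//.
apply: le_trans (le_abse_integral mu mD (measurable_int _ i2)) _.
rewrite -ge0_integralZr//; last by apply/measurable_EFinP; exact: measurableT_comp.
apply: ae_ge0_le_integral => //.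
- by apply: measurableT_comp => //; exact: measurable_int i2.
- by move=> x _; rewrite mule_ge0.
- by apply/measurable_EFinP; apply: measurable_funM => //; exact: measurableT_comp.
by apply: filterS (vk2 i) => x /[apply] h; rewrite -EFinM lee_fin normrM ler_wpM2l.
Qed.

End pairings.

Section daction_bounds.
Variables (M : R) (Q : T -> R) (envQ : envelope Q).

Lemma daction_fields : exists2 C : R, 0 <= C & forall u, in_class M Q u ->
  dominated_field Q C (dxi u) (dt u) /\ dominated_field Q C (dxi u) (dG u).
Proof.
have [C C0 hC] := class_estimates M envQ; exists C => // u uQ.
have [su _] := uQ; have := hC _ uQ => hu.
split; split.
- by move=> i j; exact: measurable_dxi.
- by move=> i; exact: measurable_dt.
- by apply: filterS hu => x /[apply] -[_ _ h] i; have [] := h i.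
- by move=> i j; exact: measurable_dxi.
- by move=> i; exact: measurable_dG.
- by apply: filterS hu => x /[apply] -[_ h1 h2] i; have [] := h2 i.
Qed.

Lemma dominated_fieldB C C' f f' b b' : dominated_field Q C f b ->
  dominated_field Q C' f' b' ->
  dominated_field Q (C + C') (fun i j x => f i j x - f' i j x) (fun i x => b i x - b' i x).
Proof.
move=> [mf mb fb] [mf' mb' fb']; split.
- by move=> i j; exact: measurable_funB.
- by move=> i; exact: measurable_funB.
apply: filterS2 fb fb' => x h h' Dx i; have [h1 h2] := h Dx i; have [h1' h2'] := h' Dx i.
split=> [j|]; apply: le_trans (ler_normB _ _) _; rewrite mulrDl; exact: lerD.
Qed.

Lemma dominated_field_sub C f b b' : dominated_field Q C f b -> dominated_field Q C f b' ->
  dominated_field Q (C + C) f (fun i x => b i x - b' i x).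
Proof.
move=> [mf mb fb] [mf' mb' fb']; split => //.
  by move=> i; exact: measurable_funB.
apply: filterS2 fb fb' => x h h' Dx i; have [h1 h2] := h Dx i; have [h1' h2'] := h' Dx i.
split=> [j|]; last by apply: le_trans (ler_normB _ _) _; rewrite mulrDl; exact: lerD.
(* C Q^(1/p') dominates an absolute value, so it is nonnegative and may be doubled. *)
by rewrite mulrDl; apply: le_trans (h1 j) _; rewrite lerDl; apply: le_trans (h1 j).
Qed.

Lemma pairingB C C' f f' b b' v : dominated_field Q C f b -> dominated_field Q C' f' b' ->
  in_class M Q v ->
  pairing f b v - pairing f' b' v =
  pairing (fun i j x => f i j x - f' i j x) (fun i x => b i x - b' i x) v.
Proof.
move=> fb fb' vQ; rewrite /pairing -sumrB; apply: eq_bigr => i _.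
have [i1 i2 _] := pairing_integrable envQ fb i vQ.
have [i1' i2' _] := pairing_integrable envQ fb' i vQ.
rewrite opprD addrACA -!RintegralB//; congr (_ + _); apply: eq_Rintegral => x _.
  by rewrite -sumrB; apply: eq_bigr => j _; rewrite mulrBl.
by rewrite mulrBl.
Qed.

Lemma dactionE u v : in_class M Q u -> in_class M Q v ->
  daction u v = pairing (dxi u) (fun i x => dt u i x - dG u i x) v.
Proof.
move=> uQ vQ; have [C C0 /(_ _ uQ)[ft fG]] := daction_fields.
rewrite /daction /pairing; apply: eq_bigr => i _.
have [i1 i2 _] := pairing_integrable envQ ft i vQ.
have [_ i2' _] := pairing_integrable envQ fG i vQ.
rewrite -addrA -RintegralB//; congr (_ + _); apply: eq_Rintegral => x _.
by rewrite mulrBl.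
Qed.

(** The two consequences of a norm at most k in X that the estimates use; see [normX_small]. *)
Definition small_direction v (k : R) :=
  (forall i, Lp_norm mu D (p i) (fun x => enorm ((v i).2 x)) <= k%:E)%E /\
  (forall i, \forall x \ae mu, D x -> `|(v i).1 x| <= k).

Definition daction_norm u : \bar R :=
  pairing_norm (dxi u) (fun i x => dt u i x - dG u i x).

Lemma daction_norm_lty u : in_class M Q u -> (daction_norm u < +oo)%E.
Proof.
move=> uQ; have [C C0 /(_ _ uQ)[ft fG]] := daction_fields.
have CC0 : 0 <= C + C by exact: addr_ge0.
exact: (pairing_norm_lty envQ CC0 (dominated_field_sub ft fG)).
Qed.

Lemma daction_le u v k : in_class M Q u -> in_class M Q v -> 0 <= k ->
  small_direction v k -> (`|daction u v|%:E <= daction_norm u * k%:E)%E.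
Proof.
move=> uQ vQ k0 [v1 v2]; have [C C0 /(_ _ uQ)[ft fG]] := daction_fields.
rewrite dactionE//; exact: (pairing_le envQ (dominated_field_sub ft fG) k0 vQ v1 v2).
Qed.

Lemma daction_gap w u v k : in_class M Q w -> in_class M Q u -> in_class M Q v -> 0 <= k ->
  small_direction v k -> (`|daction w v - daction u v|%:E <= gap w u * k%:E)%E.
Proof.
move=> wQ uQ vQ k0 [v1 v2]; have [C C0 hC] := daction_fields.
have [wt wG] := hC _ wQ; have [ut uG] := hC _ uQ.
have fw := dominated_field_sub wt wG; have fu := dominated_field_sub ut uG.
rewrite !dactionE// (pairingB fw fu vQ).
exact: (pairing_le envQ (dominated_fieldB fw fu) k0 vQ v1 v2).
Qed.

End daction_bounds.

(** * Joint classes, segments of states and admissible states *)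

Lemma in_class_mono M M' Q Q' u : M <= M' -> (forall x, Q x <= Q' x) ->
  in_class M Q u -> in_class M' Q' u.
Proof.
move=> MM' QQ' [su uQ]; split => //; apply: filterS uQ => x /[apply] h i.
by have [h1 h2] := h i; split; [exact: le_trans MM'|exact: le_trans (QQ' x)].
Qed.

Lemma envelopeD Q Q' : envelope Q -> envelope Q' -> envelope (fun x => Q x + Q' x).
Proof.
move=> [iQ Q1] [iQ' Q1']; split; last by move=> x; have := Q1 x; have := Q1' x; lra.
rewrite (_ : _ \o _ = ((EFin \o Q) \+ (EFin \o Q'))%E); first exact: integrableD.
by apply/funext.
Qed.

Lemma envelopeZ Q (k : R) : 1 <= k -> envelope Q -> envelope (fun x => k * Q x).
Proof.
move=> k1 eQ; split; first exact: integrable_envelopeZ.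
by move=> x; have := eQ.2 x; nra.
Qed.

Definition shift_state u (r : R) v : state :=
  fun i => (fun x => (u i).1 x + r * (v i).1 x, fun x => (u i).2 x + r *: (v i).2 x).

Lemma measurable_shift_state u r v : measurable_state u -> measurable_state v ->
  measurable_state (shift_state u r v).
Proof.
move=> hu hv i; have [u1 u2] := hu i; have [v1 v2] := hv i; split => [|j].
  by apply: measurable_funD => //; exact: measurable_funM.
rewrite /shift_state /=; under eq_fun do rewrite !mxE.
by apply: measurable_funD => //; exact: measurable_funM.
Qed.

(** Comes from |xi + r eta|^p <= 2^p (|xi|^p + |r|^p |eta|^p) with |r| <= k. Summing over i gives
    one constant for all components, and the leading 1 ensures that multiples of envelopes are
    envelopes. *)
Definition shift_const (k : R) : R := 1 + \sum_i 2 `^ p i * (1 + k `^ p i).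

Lemma shift_const_ge1 k : 1 <= shift_const k.
Proof. by rewrite lerDl sumr_ge0// => i _;
  rewrite mulr_ge0 ?powR_ge0// addr_ge0 ?powR_ge0. Qed.

Lemma bounded_at_shift (M q r k : R) u v x : 1 <= q -> `|r| <= k ->
  bounded_at M q u x -> bounded_at M q v x ->
  bounded_at ((1 + k) * M) (shift_const k * q) (shift_state u r v) x.
Proof.
move=> q1 rk hu hv i; have [u1 u2] := hu i; have [v1 v2] := hv i; split.
  rewrite mulrDl mul1r; apply: le_trans (ler_normD _ _) _; apply: lerD => //.
  by rewrite normrM; exact: ler_pM.
have pi0 : 0 <= p i by have := p1 i; lra.
apply: le_trans (enormD_powR _ _ pi0) _.
apply: (@le_trans _ _ (2 `^ p i * (1 + k `^ p i) * q)).
  rewrite -mulrA; apply: ler_wpM2l; first exact: powR_ge0.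
  rewrite mulrDl mul1r; apply: lerD => //.
  rewrite enormZ powRM ?enorm_ge0//; apply: ler_pM; rewrite ?powR_ge0//.
  by apply: ge0_ler_powR; rewrite ?nnegrE//; apply: le_trans rk.
apply: ler_wpM2r; first by lra.
rewrite /shift_const (bigD1 i)//= addrCA lerDl addr_ge0// sumr_ge0// => j _.
by rewrite mulr_ge0 ?powR_ge0// addr_ge0 ?powR_ge0.
Qed.

Lemma in_class_shift (M r k : R) Q u v : envelope Q -> `|r| <= k ->
  in_class M Q u -> in_class M Q v ->
  in_class ((1 + k) * M) (fun x => shift_const k * Q x) (shift_state u r v).
Proof.
move=> eQ rk [hu uQ] [hv vQ]; split; first exact: measurable_shift_state.
by apply: filterS2 uQ vQ => x h h' Dx; apply: bounded_at_shift => //;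
  [exact: eQ.2|exact: h|exact: h'].
Qed.

Definition admissible u := exists M Q, envelope Q /\ in_class M Q u.

(** The estimates compare states of a single class; sums of envelopes and of absolute values of the
    bounds dominate both sets of data. *)
Lemma admissible_join u v : admissible u -> admissible v ->
  exists M Q, [/\ 0 <= M, envelope Q, in_class M Q u & in_class M Q v].
Proof.
move=> [M [Q [eQ uQ]]] [M' [Q' [eQ' vQ']]].
exists (`|M| + `|M'|), (fun x => Q x + Q' x); split.
- exact: addr_ge0.
- exact: envelopeD.
- apply: in_class_mono uQ => [|x]; last by have := eQ'.2 x; lra.
  by rewrite (le_trans (ler_norm _))// lerDl.
- apply: in_class_mono vQ' => [|x]; last by have := eQ.2 x; lra.
  by rewrite (le_trans (ler_norm _))// lerDr.
Qed.

Lemma admissible_join3 u v w : admissible u -> admissible v -> admissible w ->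
  exists M Q, [/\ envelope Q, in_class M Q u, in_class M Q v & in_class M Q w].
Proof.
move=> hu hv [M' [Q' [eQ' wQ']]]; have [M [Q [M0 eQ uQ vQ]]] := admissible_join hu hv.
have mono z : in_class M Q z -> in_class (M + `|M'|) (fun x => Q x + Q' x) z.
  by apply: in_class_mono => [|x]; [rewrite lerDl|have := eQ'.2 x; lra].
exists (M + `|M'|), (fun x => Q x + Q' x); split;
  [exact: envelopeD|exact: mono|exact: mono|].
apply: in_class_mono wQ' => [|x]; last by have := eQ.2 x; lra.
by rewrite (le_trans (ler_norm _))// lerDr.
Qed.

Lemma daction_linear u v w (c : R) : admissible u -> admissible v -> admissible w ->
  daction u (shift_state w c v) = c * daction u v + daction u w.
Proof.
move=> hu hv hw; have [M [Q [eQ uQ vQ wQ]]] := admissible_join3 hu hv hw.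
have [C C0 /(_ _ uQ)[ft fG]] := daction_fields M eQ.
rewrite /daction mulr_sumr -big_split/=; apply: eq_bigr => i _.
have [v1 v2 _] := pairing_integrable eQ ft i vQ.
have [w1 w2 _] := pairing_integrable eQ ft i wQ.
have [_ v3 _] := pairing_integrable eQ fG i vQ.
have [_ w3 _] := pairing_integrable eQ fG i wQ.
have lin (f g : T -> R) : mu.-integrable D (EFin \o f) -> mu.-integrable D (EFin \o g) ->
    \int[mu]_(x in D) (c * f x + g x) = c * \int[mu]_(x in D) f x + \int[mu]_(x in D) g x.
  move=> hf hg; rewrite RintegralD//; first by rewrite RintegralZl.
  rewrite (_ : _ \o _ = (fun x => c%:E * (EFin \o f) x)%E); first exact: integrableZl.
  by apply/funext => x; rewrite /= EFinM.
transitivity (\int[mu]_(x in D) (c * (\sum_j dxi u i j x * (v i).2 x 0 j) + \sum_j dxi u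
  i j x * (w i).2 x 0 j)
   + \int[mu]_(x in D) (c * (dt u i x * (v i).1 x) + dt u i x * (w i).1 x)
   - \int[mu]_(x in D) (c * (dG u i x * (v i).1 x) + dG u i x * (w i).1 x)).
  congr (_ + _ - _); apply: eq_Rintegral => x _ /=.
  - rewrite mulr_sumr -big_split/=; apply: eq_bigr => j _; rewrite !mxE; ring.
  - ring.
  - ring.
rewrite !lin//; ring.
Qed.

Lemma integrable_sumr (I : Type) (s : seq I) (f : I -> T -> R) :
  (forall i, mu.-integrable D (EFin \o f i)) ->
  mu.-integrable D (EFin \o (fun x => \sum_(i <- s) f i x)).
Proof.
move=> fi; rewrite (_ : _ \o _ = (fun x => \sum_(i <- s) (EFin \o f i) x)%E).
  by apply: integrable_sum.
by apply/funext => x; rewrite /= sumEFin.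
Qed.

Lemma Rintegral_sum (I : Type) (s : seq I) (f : I -> T -> R) :
  (forall i, mu.-integrable D (EFin \o f i)) ->
  \int[mu]_(x in D) (\sum_(i <- s) f i x) = \sum_(i <- s) \int[mu]_(x in D) f i x.
Proof.
move=> fi; elim: s => [|i s IH].
  rewrite big_nil; under eq_Rintegral do rewrite big_nil.
  by rewrite Rintegral_cst// mul0r.
rewrite big_cons -IH -RintegralD//; last exact: integrable_sumr.
by apply: eq_Rintegral => x _; rewrite big_cons.
Qed.

(** The envelope is 1 plus all powers of the gradients; the constant is integrable because D has
    finite measure. *)
Lemma admissibleP u : measurable_state u ->
  (forall i, exists M : R, \forall x \ae mu, D x -> `|(u i).1 x| <= M) ->
  (forall i, mu.-integrable D (EFin \o (fun x => enorm ((u i).2 x) `^ p i))) ->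
  admissible u.
Proof.
move=> hu /choice[M hM] ui.
exists (\sum_i `|M i|), (fun x => 1 + \sum_i enorm ((u i).2 x) `^ p i); split;
  last split => //.
  split; last by move=> x; rewrite lerDl sumr_ge0// => i _; exact: powR_ge0.
  rewrite (_ : _ \o _ = ((cst 1%:E) \+ (EFin \o (fun x =>
    (\sum_i enorm ((u i).2 x) `^ p i)%R)))%E).
    apply: integrableD => //; last exact: integrable_sumr.
    apply/integrableP; split => //.
    under eq_integral do rewrite /= normr1.
    by rewrite integral_cst// mul1e.
  by apply/funext => x.
apply: filterS (ae_ord hM) => x /[apply] h i; split.
  apply: le_trans (h i) _; rewrite (bigD1 i)//=; apply: le_trans (ler_norm _) _.
  by rewrite lerDl sumr_ge0.
rewrite (bigD1 i)//= addrCA lerDl addr_ge0// sumr_ge0// => j _; exact: powR_ge0.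
Qed.


Definition grad_dist w u i : \bar R :=
  Lp_norm mu D (p i) (fun x => enorm ((w i).2 x - (u i).2 x)).

(* Every subsequence has a subsequence whose gradients converge almost
   everywhere and are dominated. *)
Lemma near_cvg_action_gap (M : R) (U : nat -> state) u (e : R) : 0 < e ->
  (forall k, measurable_state (U k)) -> admissible u ->
  (forall k, \forall x \ae mu, D x -> forall i, `|(U k i).1 x| <= M) ->
  (\forall x \ae mu, D x -> forall i, (U k i).1 x @[k --> \oo] --> (u i).1 x) ->
  (forall i, grad_dist (U k) u i @[k --> \oo] --> 0%E) ->
  \forall k \near \oo, `|action (U k) - action u| < e /\ (gap (U k) u < e%:E)%E.
Proof.
move=> e0 mU [M0 [Q0 [eQ0 uQ0]]] UM Uu gU.
have p0 i : 0 < p i by have := p1 i; lra.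
pose P k := `|action (U k) - action u| < e /\ (gap (U k) u < e%:E)%E.
(* Otherwise P fails at arbitrarily large indices, and the subsequence is picked among those. *)
apply: contrapT => /= nP.
have {}nP n : exists k, (n <= k)%N /\ ~ P k.
  apply: contrapT => h; apply: nP; exists n => // k /= nk.
  by apply: contrapT => hk; apply: h; exists k.
pose g k i x : R := enorm ((U k i).2 x - (u i).2 x) `^ p i.
have mg k i : measurable_fun D (g k i).
  apply: (@measurableT_comp _ _ _ _ _ _ (@powR R ^~ _)) => //.
  apply: measurable_enorm => j; under eq_fun do rewrite !mxE.
  by apply: measurable_funB; [exact: (mU k i).2|exact: (uQ0.1 i).2].
have ig k i : (\int[mu]_(x in D) (g k i x)%:E = grad_dist (U k) u i `^ p i)%E.
  rewrite /grad_dist -integral_Lp_norm; last by rewrite gt_eqF.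
  apply: eq_integral => x _.
  by rewrite ger0_norm ?enorm_ge0.
have small n : \forall k \near \oo, forall i,
    (\int[mu]_(x in D) (g k i x)%:E <= (1 / (2 ^ n.+1)%:R)%:E)%E.
  have t0 : 0 < 1 / (2 ^ n.+1)%:R :> R by rewrite divr_gt0// ltr0n expn_gt0.
  apply: filter_forall => i; have /fine_cvgP[hf h] := gU i.
  have h' : fine (grad_dist (U k) u i) `^ p i @[k --> \oo] --> 0.
    by apply: powR_cvg0_seq => // k; rewrite fine_ge0// Lnorm_ge0.
  move/cvgr0Pnorm_le : h' => /(_ _ t0); apply: filterS2 hf => k hk.
  rewrite ger0_norm ?powR_ge0// -lee_fin -fine_poweR fineK ?fin_num_poweR//.
  by rewrite ig.
(* The n-th chosen index is bad, at least n, and has gradient errors at most 2^-(n+1), which is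
   summable. The bound n <= s n suffices for passing to limits along s. *)
have /choice[s hs] n : exists k, [/\ (n <= k)%N, ~ P k & forall i,
    (\int[mu]_(x in D) (g k i x)%:E <= (1 / (2 ^ n.+1)%:R)%:E)%E].
  have [n0 _ hn0] := small n; have [k [nk Pk]] := nP (maxn n n0).
  exists k; split => //; first exact: leq_trans (leq_maxl _ _) nk.
  by apply: hn0; exact: leq_trans (leq_maxr _ _) nk.
have soo : s n @[n --> \oo] --> \oo.
  move=> B [n0 _ hB]; exists n0 => // n /= n0n; apply: hB => /=.
  by have [h _ _] := hs n; exact: leq_trans h.
have /choice[H hH] i : exists H : T -> R, mu.-integrable D (EFin \o H) /\
    \forall x \ae mu, D x -> g (s n) i x @[n --> \oo] --> 0 /\
      forall n, 0 <= g (s n) i x <= H x.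
  apply: (summable_dominated mD (fun n => mg (s n) i)) => [n x|]; first exact: powR_ge0.
  apply: le_lt_trans (ltry 1); apply: le_trans (epsilon_trick0 xpredT ler01).
  apply: lee_nneseries => [n _ _|n _]; first by rewrite integral_ge0// => x _;
    rewrite lee_fin powR_ge0.
  by have [_ _] := hs n; apply.
(* Dictated by |U|^p <= 2^p (|U - u|^p + |u|^p) <= 2^p (H_i + Q0) for the gradient components. *)
pose k := 1 + \sum_i 2 `^ p i.
pose Q x := k * (Q0 x + \sum_i `|H i x|).
have k1 : 1 <= k by rewrite lerDl sumr_ge0// => i _; exact: powR_ge0.
have eQ : envelope Q.
  apply: envelopeZ => //; split; last first.
    by move=> x; apply: le_trans (eQ0.2 x) _; rewrite lerDl sumr_ge0.
  rewrite (_ : _ \o _ = ((EFin \o Q0) \+ (EFin \o (fun x => \sum_i `|H i x|)%R))%E);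
    last exact/funext.
  apply: integrableD => //; first exact: eQ0.1.
  by apply: integrable_sumr => i; apply: integrable_norm; exact: (hH i).1.
pose M' := `|M0| + `|M|.
have hHx := ae_ord (fun i => (hH i).2).
have Q0Q x : Q0 x <= Q x.
  have := eQ0.2 x; have : 0 <= \sum_i `|H i x| by exact: sumr_ge0.
  by rewrite /Q; nra.
have uQ : in_class M' Q u.
  by apply: in_class_mono uQ0 => //; rewrite (le_trans (ler_norm _))// lerDl.
have UQ n : in_class M' Q (U (s n)).
  split => //; apply: filterS3 hHx uQ0.2 (UM (s n)) => x hHx' hux hUx Dx i; split.
    by apply: le_trans (hUx Dx i) _; rewrite (le_trans (ler_norm _))// lerDr.
  have -> : (U (s n) i).2 x = ((U (s n) i).2 x - (u i).2 x) + (u i).2 x by rewrite subrK.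
  apply: le_trans (enormD_powR _ _ (ltW (p0 i))) _.
  rewrite /Q; apply: ler_pM; rewrite ?powR_ge0 ?addr_ge0 ?powR_ge0//.
    by rewrite /k (bigD1 i)//= addrCA lerDl addr_ge0// sumr_ge0// => j _; exact: powR_ge0.
  rewrite addrC; apply: lerD; first by have [] := hux Dx i.
  have [_ /(_ n)/andP[_]] := hHx' Dx i; move/le_trans; apply.
  by rewrite (bigD1 i)//=; apply: le_trans (ler_norm _) _; rewrite lerDl sumr_ge0.
have Uu' : \forall x \ae mu, D x -> forall i,
  (U (s n) i).1 x @[n --> \oo] --> (u i).1 x /\ (U (s n) i).2 x @[n --> \oo] --> (u i).2 x.
  apply: filterS2 hHx Uu => x h1 h2 Dx i; split.
    exact: (@cvg_comp _ _ _ s (fun k => (U k i).1 x) _ _ _ soo (h2 Dx i)).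
  by apply: (cvg_enorm_powR (p0 i)); have [] := h1 Dx i.
have c1 : action (U (s n)) @[n --> \oo] -->
  action u by exact: (dominated_cvg_action eQ UQ Uu').
have c2 : gap (U (s n)) u @[n --> \oo] --> 0%E by exact: (dominated_cvg_gap eQ UQ uQ Uu').
(* Convergence along s makes P hold at some [s n1], contrary to the choice of s. *)
have [n1 _ hn1] : \forall n \near \oo, P (s n).
  move/cvgrPdist_lt : c1 => /(_ _ e0) c1.
  move/fine_cvgP : c2 => [c2f /cvgr0Pnorm_lt/(_ _ e0) c2].
  near=> n; split; first by rewrite distrC; near: n.
  have hfin : gap (U (s n)) u \is a fin_num by near: n.
  rewrite -(fineK hfin) lte_fin; apply: le_lt_trans (ler_norm _) _.
  by near: n.
by have [_ + _] := hs n1; apply; exact: (hn1 n1 (leqnn n1)).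
Unshelve. all: by end_near. Qed.

(** If no radius worked, bad states for the radii 1/(n+1) would form a sequence converging to u
    almost everywhere, with values bounded by M + 1 and gradients converging in L^p, against
    [near_cvg_action_gap]. *)
Lemma small_action_gap u (e : R) : 0 < e -> admissible u -> exists2 r : R, 0 < r <= 1 &
  forall w, measurable_state w -> (forall i, grad_dist w u i <= r%:E)%E ->
    (forall i, \forall x \ae mu, D x -> `|(w i).1 x - (u i).1 x| <= r) ->
    (gap w u < e%:E)%E.
Proof.
move=> e0 hu; apply: contrapT => h.
have h1 (n : nat) : 0 < (n.+1%:R^-1 : R) <= 1 by rewrite invr_gt0 ltr0n/= invf_le1// ler1n.
have /choice[U hU] n : exists w, [/\ measurable_state w,
    (forall i, grad_dist w u i <= (n.+1%:R^-1)%:E)%E,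
    (forall i, \forall x \ae mu, D x -> `|(w i).1 x - (u i).1 x| <= n.+1%:R^-1) &
    ~ (gap w u < e%:E)%E].
  apply: contrapT => h2; apply: h; exists n.+1%:R^-1 => // w w1 w2 w3.
  by apply: contrapT => w4; apply: h2; exists w.
have [M [Q [eQ [su uQ]]]] := hu.
have cU : \forall x \ae mu, forall n, D x ->
  forall i, `|(U n i).1 x - (u i).1 x| <= n.+1%:R^-1.
  by apply: ae_foralln => n; apply: ae_ord => i; have [_ _ + _] := hU n; apply.
have [||||n1 _ hn1] := @near_cvg_action_gap (M + 1) U u e e0 _ hu.
- by move=> k; have [] := hU k.
- move=> k; apply: filterS2 cU uQ => x h2 h3 Dx i; have [h4 _] := h3 Dx i.
  have := h2 k Dx i; have /andP[_] := h1 k.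
  move=> h5 h6; rewrite -(subrK ((u i).1 x) ((U k i).1 x));
    apply: le_trans (ler_normD _ _) _.
  rewrite addrC; apply: lerD => //; exact: le_trans h6 _.
- apply: filterS cU => x h2 Dx i; apply/subr_cvg0; apply: norm_cvg0.
  apply: (@squeeze_cvgr _ _ _ _ (cst 0) _ _ _ _ _ cvg_harmonic); last exact: cvg_cst.
  by apply: nearW => k /=; rewrite normr_ge0/=; exact: h2.
- move=> i; apply: (@squeeze_cvge _ _ _ _ (cst 0%E) _ (fun n => (n.+1%:R^-1)%:E)).
  + apply: nearW => k; rewrite Lnorm_ge0/=; have [_ h2 _ _] := hU k; exact: h2.
  + exact: cvg_cst.
  + exact: cvge_harmonic.
have [_ _ _] := hU n1; apply; exact: (hn1 n1 (leqnn _)).2.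
Qed.


(** * Derivative along a segment and the Frechet estimate *)

Lemma diff_jet (f : V -> R) (y : V) (t : R) (xi : 'rV[R]_N) : differentiable f y ->
  'd f y ((t, xi) : V) = \sum_j 'd f y (0, delta_mx 0 j) * xi 0 j + 'd f y (1, 0) * t.
Proof.
move=> df.
have -> : ((t, xi) : V) = \sum_j xi 0 j *: ((0, delta_mx 0 j) : V) + t *: ((1, 0) : V).
  have -> : \sum_j xi 0 j *: ((0, delta_mx 0 j) : V) = (0, xi).
    rewrite [in RHS](row_sum_delta xi).
    apply: (big_rec2 (fun (c : V) e => c = (0, e))) => // j c e _ ->.
    by congr pair; rewrite /= scaler0 addr0.
  by congr pair; rewrite /= ?scaler0 ?addr0 ?add0r// /GRing.scale/= mulr1.
rewrite linearD linearZ/= linear_sum/=; congr (_ + _); last by rewrite mulrC.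
by apply: eq_bigr => j _; rewrite linearZ/= mulrC.
Qed.

Lemma diff_svals (f : 'rV[R]_m -> R) (y z : 'rV[R]_m) : differentiable f y ->
  'd f y z = \sum_i 'd f y (delta_mx 0 i) * z 0 i.
Proof.
move=> df; rewrite {1}(row_sum_delta z) linear_sum/=.
by apply: eq_bigr => j _; rewrite linearZ/= mulrC.
Qed.

Section mean_value.
Variables (M : R) (Q : T -> R) (envQ : envelope Q).
Variables (u v : state) (uQ : in_class M Q u) (vQ : in_class M Q v).

Local Notation line r := (shift_state u r v).

(** The segment parameter r runs over ](-1), 2[, where |r| <= 2; [M2] and [Q2] are the data of
    [in_class_shift] for k = 2, uniform in r. *)
Let M2 : R := (1 + 2) * M.
Let Q2 : T -> R := fun x => shift_const 2 * Q x.
Let envQ2 : envelope Q2. Proof. exact: (envelopeZ (shift_const_ge1 2) envQ). Qed.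

(** Each integral is differentiated separately under the integral sign; on ](-1), 2[ the
    r-derivatives of the integrands are dominated by a fixed multiple of [Q2]. *)
Lemma action_line_derive (s : R) : s \in `](-1), 2[ ->
  is_derive s 1 (fun r => action (line r)) (daction (line s) v).
Proof.
move=> s12.
(* Integrability is required at every real r, so here the class depends on |r|. *)
have iclass (r : R) : in_class ((1 + `|r|) * M) (fun x => shift_const `|r| * Q x) (line r).
  exact: in_class_shift.
have env r : envelope (fun x => shift_const r * Q x).
  exact: (envelopeZ (shift_const_ge1 r) envQ).
have ic2 (r : R) : r \in `](-1), 2[ -> `|r| <= 2 by rewrite in_itv/= ler_norml; lra.
have [C C0 hC] := growth_at M2.
have hline : \forall x \ae mu, D x -> forall r : R, r \in `](-1), 2[ ->
   bounded_at M2 (Q2 x) (line r) x /\ bounded_at M2 (Q2 x) v x.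
  apply: filterS2 uQ.2 vQ.2 => x hu hv Dx r rI; split.
    by apply: bounded_at_shift; [exact: envQ.2|exact: ic2|exact: hu|exact: hv].
  have M0 (i : 'I_m) : 0 <= M by have [h _] := hv Dx i; exact: le_trans h.
  move=> i; have [h1 h2] := hv Dx i; split.
    by rewrite /M2 mulrDl mul1r (le_trans h1)// lerDl mulr_ge0// (M0 i).
  by rewrite /Q2; apply: le_trans h2 _; rewrite ler_peMl ?shift_const_ge1// (le_trans
    ler01 (envQ.2 x)).
have mline r : measurable_state (line r) by exact: (iclass r).1.
have mv := vQ.1.
have mF' i r : measurable_fun D (fun x => \sum_j dxi (line r) i j x * (v i).2 x 0 j + dt
  (line r) i x * (v i).1 x).
  apply: measurable_funD.
    by apply: measurable_sum => j; apply: measurable_funM;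
      [exact: measurable_dxi|exact: (mv i).2].
  by apply: measurable_funM; [exact: measurable_dt|exact: (mv i).1].
have mG' r : measurable_fun D (fun x => \sum_i dG (line r) i x * (v i).1 x).
  by apply: measurable_sum => i; apply: measurable_funM;
    [exact: measurable_dG|exact: (mv i).1].
have da i : is_derive s 1 (fun r => \int[mu]_(x in D) a i x (jet (line r) i x))
   (\int[mu]_(x in D) (\sum_j dxi (line s) i j x * (v i).2 x 0 j + dt (line s) i x * (v
     i).1 x)).
  (* In H, N C bounds the gradient part and C M2 the value part, both by [pairing_pointwise]. *)
  apply: (is_derive_Rintegral cmu mD (F := fun r x => a i x (jet (line r) i x))
    (F' := fun r x => \sum_j dxi (line r) i j x * (v i).2 x 0 j + dt (line r) i x * (v
      i).1 x)
    (H := fun x => (N%:R * C + C * M2) * Q2 x) _ _ _ _ s12).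
  - by move=> r; have [_ _ /(_ i)[]] := integrable_class (env `|r|) (iclass r).
  - exact: mF'.
  - apply: filterS3 hC hline (ca i) => x h1 h2 h3 Dx r rI.
    have [df _] := h3 Dx; have [h4 h5] := h2 Dx r rI.
    split.
      have -> : \sum_j dxi (line r) i j x * (v i).2 x 0 j + dt (line r) i x * (v i).1 x =
        'd (a i x) (jet u i x + r *: jet v i x) (jet v i x) by rewrite /jet diff_jet.
      by apply: is_derive_line; exact: df.
    have [_ _ /(_ i)[_ h6 h7]] := h1 Dx _ _ (envQ2.2 x) h4.
    have [h8 h9] := h5 i.
    have [h10 h11] := pairing_pointwise (envQ2.2 x) h9 h8 h7 h6.
    by rewrite mulrDl; apply: le_trans (ler_normD _ _) _; exact: lerD.
  - exact: integrable_envelopeZ.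
have dGs : is_derive s 1 (fun r => \int[mu]_(x in D) G x (svals (line r) x))
   (\int[mu]_(x in D) (\sum_i dG (line s) i x * (v i).1 x)).
  apply: (is_derive_Rintegral cmu mD (F := fun r x => G x (svals (line r) x))
    (F' := fun r x => \sum_i dG (line r) i x * (v i).1 x)
    (H := fun x => (m%:R * (C * M2)) * Q2 x) _ _ _ _ s12).
  - by move=> r; have [] := integrable_class (env `|r|) (iclass r).
  - exact: mG'.
  - apply: filterS3 hC hline cG => x h1 h2 h3 Dx r rI.
    have [df _] := h3 Dx; have [h4 h5] := h2 Dx r rI.
    have sE r' : svals (line r') x = svals u x + r' *: svals v x by apply/rowP => i;
      rewrite !mxE.
    split.
      have -> : \sum_i dG (line r) i x * (v i).1 x =
        'd (G x) (svals u x + r *: svals v x) (svals v x).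
        rewrite diff_svals//; apply: eq_bigr => i _; rewrite /dG sE.
        by congr (_ * _); rewrite mxE.
      under eq_fun do rewrite sE.
      by apply: is_derive_line; exact: df.
    have [_ h6 _] := h1 Dx _ _ (envQ2.2 x) h4.
    apply: le_trans (ler_norm_sum _ _ _) _.
    apply: (@le_trans _ _ (\sum_(i < m) C * M2 * Q2 x)).
      apply: ler_sum => i _; rewrite normrM mulrAC; apply: ler_pM => //.
      by have [] := h5 i.
    by rewrite sumr_const card_ord -[leLHS]mulr_natl mulrA.
  - exact: integrable_envelopeZ.
have lineQ : in_class M2 Q2 (line s) by exact: (in_class_shift envQ (ic2 _ s12) uQ vQ).
have vQ2 : in_class M2 Q2 v.
  split => //; apply: filterS hline => x /[apply] /(_ s s12) [_]; exact.
have [C' C0' /(_ _ lineQ)[ft fG]] := daction_fields M2 envQ2.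
(* The integral of G occurs once in [action], whereas [daction] splits its derivative over the
   components; the finite sum is moved out of the integral. *)
have -> : daction (line s) v = \sum_i (\int[mu]_(x in D)
     (\sum_j dxi (line s) i j x * (v i).2 x 0 j + dt (line s) i x * (v i).1 x)) -
   \int[mu]_(x in D) (\sum_i dG (line s) i x * (v i).1 x).
  rewrite Rintegral_sum; last by move=> i; have [] := pairing_integrable envQ2 fG i vQ2.
  rewrite -sumrB; apply: eq_bigr => i _; rewrite RintegralD//.
    by have [] := pairing_integrable envQ2 ft i vQ2.
  by have [] := pairing_integrable envQ2 ft i vQ2.
have -> : (fun r => action (line r)) =
  \sum_(i < m) (fun r => \int[mu]_(x in D) a i x (jet (line r) i x)) -
  (fun r => \int[mu]_(x in D) G x (svals (line r) x)).
  by apply/funext => r; rewrite /action !fctE fct_sumE.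
by apply: is_deriveB; exact: is_derive_sum.
Qed.

Lemma action_mean_value : exists2 s : R, 0 < s < 1 &
  action (line 1) - action u = daction (line s) v.
Proof.
have [s s01 h] := mean_value01 action_line_derive; exists s => //.
rewrite -h; congr (_ - action _).
by apply/funext => i; rewrite /shift_state; case: (u i) => u1 u2; congr pair;
  apply/funext => x /=; rewrite ?mul0r ?scale0r addr0.
Qed.

End mean_value.

(** The remainder is (dJ(u + s v) - dJ(u))[v] for some s depending on v. As 0 < s < 1, u + s v stays
    within k of u, and [small_action_gap], uniform over such states, makes the gap smaller than
    e. *)
Lemma action_frechet u (e : R) : 0 < e -> admissible u -> exists2 r : R, 0 < r &
  forall v k, 0 <= k -> k < r -> admissible v -> small_direction v k ->
    `|action (shift_state u 1 v) - action u - daction u v| <= e * k.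
Proof.
move=> e0 hu; have [r /andP[r0 r1] hr] := small_action_gap e0 hu.
exists r => // v k k0 kr hv vk; have [M [Q [M0 eQ uQ vQ]]] := admissible_join hu hv.
have [s /andP[s0 s1] ->] := action_mean_value eQ uQ vQ.
have c1 := shift_const_ge1 1.
have eQ1 := envelopeZ c1 eQ.
have mono w : in_class M Q w -> in_class ((1 + 1) * M) (fun x => shift_const 1 * Q x) w.
  apply: in_class_mono => [|x]; first by lra.
  by have := eQ.2 x; nra.
have sQ : in_class ((1 + 1) * M) (fun x => shift_const 1 * Q x) (shift_state u s v).
  by apply: in_class_shift => //; rewrite ger0_norm; lra.
have := daction_gap eQ1 sQ (mono _ uQ) (mono _ vQ) k0 vk.
rewrite -lee_fin => /le_trans; apply; rewrite EFinM; apply: lee_wpmul2r;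
  first by rewrite lee_fin.
apply/ltW/hr; first exact: sQ.1.
- move=> i; have [/(_ i) h _] := vk; apply: (@le_trans _ _ k%:E);
    last by rewrite lee_fin ltW.
  apply: le_trans h; rewrite /grad_dist; apply: le_Lp_norm => //; last 1 first.
  + move=> x; rewrite /shift_state /= addrAC subrr add0r enormZ normrM normr_id.
    by rewrite (gtr0_norm s0) ler_piMl// ltW.
  + by have := p1 i; lra.
  + apply: measurable_enorm => j.
    rewrite (_ : (fun x => _) = (fun x => (shift_state u s v i).2 x 0 j - (u i).2 x 0 j)).
      by apply: measurable_funB; [exact: (sQ.1 i).2|exact: (uQ.1 i).2].
    by apply/funext => x; rewrite !mxE.
  + by apply: measurable_enorm => j; exact: (vQ.1 i).2.
move=> i; have [_ /(_ i)] := vk; apply: filterS => x /[apply] h.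
rewrite /shift_state /= addrAC subrr add0r normrM (gtr0_norm s0).
by apply: le_trans (ltW kr); apply: le_trans h; rewrite ler_piMl// ltW.
Qed.

End functional.

(** * Estimates on the nonlinearities *)

Section partial_derivatives.
Variables (R : realType) (N : nat).
Local Notation V := (R^o * 'rV[R]_N)%type.

(** This and [partial_diff] turn [A_t] and [A_xi] into values of the joint differential in (t, xi),
    the form used in the abstract setting. *)
Lemma derive1_diff (f : V -> R) (t : R) (xi : 'rV[R]_N) : differentiable f (t, xi) ->
  derive1 (fun s => f (s, xi)) t = 'd f ((t, xi) : V) (1, 0).
Proof.
move=> df; rewrite derive1E -deriveE// /derive.
suff -> : (fun h : R => h^-1 *: (((fun s => f (s, xi)) \o shift t) (h *: 1) - f (t, xi))) =
  (fun h => h^-1 *: ((f \o shift ((t, xi) : V)) (h *: ((1, 0) : V)) - f (t, xi))) by [].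
apply/funext => h /=; congr (_ *: (f _ - _)).
by congr pair; rewrite /= scaler0 add0r.
Qed.

Lemma partial_diff (f : V -> R) (t : R) (xi : 'rV[R]_N) j : differentiable f (t, xi) ->
  partial j (fun z => f (t, z)) xi = 'd f ((t, xi) : V) (0, delta_mx 0 j).
Proof.
move=> df; rewrite /partial -deriveE// /derive.
suff -> : (fun h : R => h^-1 *: (((fun z =>
  f (t, z)) \o shift xi) (h *: delta_mx 0 j) - f (t, xi))) =
  (fun h => h^-1 *: ((f \o shift ((t, xi) : V)) (h *: ((0, delta_mx 0 j) :
    V)) - f (t, xi))) by [].
apply/funext => h /=; congr (_ *: (f _ - _)).
by congr pair; rewrite /= scaler0 add0r.
Qed.

End partial_derivatives.

Section bounds.
Variable R : realType.

Lemma continuous_bounded (f : R -> R) (M : R) : continuous f ->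
  exists2 B, 0 <= B & forall t, `|t| <= M -> f t <= B.
Proof.
(* Taking |M| keeps the interval nonempty when M is negative. *)
move=> cf; have MM : - `|M| <= `|M| by rewrite ge0_cp.
have [c _ hc] := EVT_max MM (continuous_subspaceT cf).
exists `|f c| => // t tM; apply: le_trans (ler_norm _); apply: hc.
by rewrite in_itv /= -ler_norml (le_trans tM)// ler_norm.
Qed.

(** The case e = 1 makes the terms eventually finite, which reduces the claim to real sequences. *)
Lemma squeeze_ereal0 (x : nat -> \bar R) :
  (forall e : R, 0 < e -> \forall n \near \oo, (0 <= x n)%E /\ (x n < e%:E)%E) ->
  x @ \oo --> 0%E.
Proof.
move=> h; apply/fine_cvgP; split.
  apply: filterS (h 1 ltr01) => n [x0 x1]; rewrite ge0_fin_numE//.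
  exact: lt_trans x1 (ltry 1).
apply/cvgr0Pnorm_lt => e e0; apply: filterS (h e e0) => n [x0 x1] /=.
rewrite ger0_norm ?fine_ge0// -lte_fin fineK// ge0_fin_numE//.
exact: lt_trans x1 (ltry e).
Qed.

End bounds.

Section translation.
Variables (R : realType) (N : nat) (Omega : set 'rV[R]_N).
Local Notation E := 'rV[R]_N.
Local Notation mu := (leb R N).
Local Notation T := (lebT R N).

Lemma ae_onS (P Q : E -> Prop) : (forall x, Omega x -> P x -> Q x) ->
  ae_on Omega P -> ae_on Omega Q.
Proof.
move=> h; apply: (@filterS _ _ (ae_filter_ringOfSetsType mu)) => x hP Ox.
exact: h (hP Ox).
Qed.

Lemma ae_onS2 (P Q S : E -> Prop) : (forall x, Omega x -> P x -> Q x -> S x) ->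
  ae_on Omega P -> ae_on Omega Q -> ae_on Omega S.
Proof.
move=> h; apply: (@filterS2 _ _ (ae_filter_ringOfSetsType mu)) => x hP hQ Ox.
exact: h (hP Ox) (hQ Ox).
Qed.

Lemma ae_onS3 (P Q S P' : E -> Prop) : (forall x, Omega x -> P x -> Q x -> S x -> P' x) ->
  ae_on Omega P -> ae_on Omega Q -> ae_on Omega S -> ae_on Omega P'.
Proof.
move=> h; apply: (@filterS3 _ _ (ae_filter_ringOfSetsType mu)) => x hP hQ hS Ox.
exact: h (hP Ox) (hQ Ox) (hS Ox).
Qed.

Lemma ae_on_ord n (P : 'I_n -> E -> Prop) : (forall i, ae_on Omega (P i)) ->
  ae_on Omega (fun x => forall i, P i x).
Proof. exact: ae_ord. Qed.

(** The essential supremum is a bound almost everywhere; in the degenerate case of a null space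
    every property holds almost everywhere. *)
Lemma ae_le_norm_Linfty (f : E -> R) (k : R) : (norm_Lp Omega +oo f <= k%:E)%E ->
  ae_on Omega (fun x => `|f x| <= k).
Proof.
rewrite /norm_Lp unlock; case: ifPn => [mu0|].
  move/ess_supP; apply: (@filterS _ _ (ae_filter_ringOfSetsType mu)) => x /= + Ox.
  by rewrite patchE mem_set// lee_fin.
rewrite -leNgt measure_le0 => /eqP mu0 _; exact: (@measure0_ae _ _ _ mu).
Qed.


(** The six continuous functions of t are bounded above on [-M, M] by compactness; C adds up their
    bounds to serve all three estimates. *)
Lemma growth_A_bound (p : R) (A : E -> R -> E -> R) :
  C1_Caratheodory Omega (fun x (w : R^o * E) => A x w.1 w.2) -> growth_A Omega p A ->
  forall M : R, exists2 C : R, 0 <= C &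
  ae_on Omega (fun x => forall (t : R) (xi : E), `|t| <= M ->
  [/\ `|A x t xi| <= C * (1 + enorm xi `^ p),
      `|'d (fun w : R^o * E => A x w.1 w.2) ((t, xi) :
        R^o * E) (1, 0)| <= C * (1 + enorm xi `^ p) &
      forall j : 'I_N, `|'d (fun w : R^o * E =>
        A x w.1 w.2) ((t, xi) : R^o * E) (0, delta_mx 0 j)| <=
        C * (1 + enorm xi `^ (p - 1)) ]).
Proof.
move=> [_ cA] [P0 [f0 [P1 [f1 [P2 [f2 [[p0 k0 p1] [[k1 p2 k2] hA]]]]]]]] M.
have [B0 B00 b0] := continuous_bounded M p0.1.
have [C0 C00 c0] := continuous_bounded M k0.1.
have [B1 B10 b1] := continuous_bounded M p1.1.
have [C1 C10 c1] := continuous_bounded M k1.1.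
have [B2 B20 b2] := continuous_bounded M p2.1.
have [C2 C20 c2] := continuous_bounded M k2.1.
pose C := B0 + C0 + B1 + C1 + B2 + C2.
have le (b c e y z w : R) : 0 <= e -> y <= z + w * e -> z <= b -> w <= c -> b <= C ->
  c <= C ->
    y <= C * (1 + e).
  move=> e0 yz zb wc bC cC; rewrite mulrDr mulr1; apply: le_trans yz _; apply: lerD.
    exact: le_trans bC.
  by rewrite ler_wpM2r// (le_trans wc).
exists C; first by rewrite /C; lra.
apply: ae_onS2 cA hA => x Ox [dA _] h2 t xi tM.
have [a1 a2 a3] := h2 t xi.
have e1 := powR_ge0 (enorm xi) p; have e2 := powR_ge0 (enorm xi) (p - 1).
split.
- by apply: (le _ _ _ _ _ _ e1 a1 (b0 _ tM) (c0 _ tM)); rewrite /C; lra.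
- rewrite -(derive1_diff (f := fun w : R^o * E => A x w.1 w.2))//.
  by apply: (le _ _ _ _ _ _ e1 a2 (b1 _ tM) (c1 _ tM)); rewrite /C; lra.
move=> j; rewrite -(partial_diff (f := fun w : R^o * E => A x w.1 w.2))//.
apply: (@le_trans _ _ (enorm (A_xi A x t xi))).
  by apply: le_trans (coord_le_enorm _ j); rewrite /A_xi /gradient mxE.
by apply: (le _ _ _ _ _ _ e2 a3 (b2 _ tM) (c2 _ tM)); rewrite /C; lra.
Qed.

(** The growth condition concerns the derivatives only. The bound on G itself comes from the mean
    value theorem on the segment from 0 to w, starting from the bounded function G(., 0). *)
Lemma growth_G_bound m (G : E -> 'rV[R]_m -> R) :
  C1_Caratheodory Omega G -> in_Lp Omega +oo%E (fun x => G x 0) -> growth_G Omega G ->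
  forall M : R, exists2 C : R, 0 <= C &
  ae_on Omega (fun x => forall w : 'rV[R]_m, (forall i, `|w 0 i| <= M) ->
  `|G x w| <= C /\ forall i, `|'d (G x) w (delta_mx 0 i)| <= C).
Proof.
move=> [_ cG] [_ G0] [sigma [q [s [s0 q1 sp hG]]]] M.
have [B hB] : exists B : R, (norm_Lp Omega +oo (fun x => G x 0%R) <= B%:E)%E.
  exists (fine (norm_Lp Omega +oo%E (fun x => G x 0))).
  by rewrite fineK// ge0_fin_numE// Lnorm_ge0.
have hB' := ae_le_norm_Linfty hB.
(* Monotonicity of powers needs a nonnegative bound, and M has no prescribed sign. *)
pose M1 := 1 + `|M|.
have M10 : 0 <= M1 by rewrite addr_ge0.
pose c i := sigma * (1 + M1 `^ (q i - 1) + \sum_(j < m | j != i) M1 `^ (s i j)).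
have c0 i : 0 <= c i.
  apply: mulr_ge0; first exact: ltW.
  by rewrite addr_ge0 ?addr_ge0 ?powR_ge0// sumr_ge0// => j _; exact: powR_ge0.
pose Cd := \sum_i c i.
have Cd0 : 0 <= Cd by exact: sumr_ge0.
exists (`|B| + Cd + m%:R * (Cd * `|M|)).
  by rewrite !addr_ge0// mulr_ge0// mulr_ge0.
have hG' : ae_on Omega (fun x => forall i, forall u : 'rV[R]_m,
          `|G_u G i x u| <= sigma * (1 + `|u 0 i| `^ (q i - 1) +
             \sum_(j < m | j != i) `|u 0 j| `^ (s i j))) by exact: ae_on_ord hG.
apply: ae_onS3 cG hB' hG' => x Ox [dG _] h2 h3 w wM.
have bd (z : 'rV[R]_m) i : (forall i, `|z 0 i| <= M) -> `|'d (G x) z (delta_mx 0 i)| <= Cd.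
  move=> zM; rewrite -deriveE//; apply: le_trans (h3 i z) _.
  have zM1 j : `|z 0 j| <= M1 by apply: le_trans (zM j) _;
    rewrite (le_trans (ler_norm _))// lerDr.
  apply: (@le_trans _ _ (c i)); last by rewrite /Cd (bigD1 i)//= lerDl sumr_ge0.
  rewrite /c ler_wpM2l ?(ltW s0)//; apply: lerD.
    by rewrite lerD2l ge0_ler_powR ?nnegrE// subr_ge0.
  by apply: ler_sum => j ji; rewrite ge0_ler_powR ?nnegrE// sp.
split; last first.
  move=> i; apply: le_trans (bd w i wM) _; rewrite -addrA addrCA lerDl.
  by rewrite addr_ge0// mulr_ge0// mulr_ge0.
have [r /andP[r0 r1] hr] := mean_value01 (fun s (_ : s \in `](-1), 2[) =>
  is_derive_line (v := w) (dG (0 + s *: w))).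
have -> : G x w = 'd (G x) (0 + r *: w) w + G x 0.
  by rewrite -hr scale1r scale0r !add0r subrK.
rewrite add0r (diff_svals _ (dG _)).
apply: le_trans (ler_normD _ _) _; rewrite addrC -addrA; apply: lerD.
  by apply: le_trans h2 _; exact: ler_norm.
apply: ler_wpDl => //; apply: le_trans (ler_norm_sum _ _ _) _.
have M0 (i : 'I_m) : 0 <= M by exact: le_trans (wM i).
apply: (@le_trans _ _ (\sum_(i < m) Cd * `|M|)).
  apply: ler_sum => i _; rewrite normrM; apply: ler_pM => //; last first.
    by apply: le_trans (wM i) _; exact: ler_norm.
  apply: bd => j; rewrite mxE normrM (ger0_norm (ltW r0)); apply: le_trans (wM j).
  by rewrite ler_piMl// ltW.
by rewrite sumr_const card_ord -[leLHS]mulr_natl.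
Qed.

End translation.

(** * The zero element of X *)

Section zero.
Variables (R : realType) (N m : nat) (Omega : set 'rV[R]_N) (p : 'I_m -> R).
Hypothesis p1 : forall i, 1 < p i.

Lemma partial0 n (i : 'I_n) : partial i (cst 0 : 'rV[R]_n -> R) = cst 0.
Proof. by apply/funext => x; rewrite /partial derive_cst. Qed.

Lemma test_function0 : test_function Omega (cst 0).
Proof.
have -> : test_function Omega (cst 0) =
  [/\ smooth (cst 0 : 'rV[R]_N -> R), compact (set0 : set 'rV[R]_N) & set0 `<=` Omega].
  rewrite /test_function /=.
  suff -> : [set x : 'rV[R]_N | cst (0 : R) x != 0] = set0 by rewrite closure0.
  by apply/seteqP; split => x //=; rewrite eqxx.
split => //; last exact: compact0.
move=> s x; suff -> : foldr (@partial R N) (cst 0) s = cst 0 by exact: differentiable_cst.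
by elim: s => //= i s ->; exact: partial0.
Qed.

Lemma norm_Lp0 q : q != 0%E -> norm_Lp Omega q (fun=> 0) = 0%E.
Proof.
move=> q0; rewrite /norm_Lp -(Lnorm0 (leb R N) q0); apply: eq_Lnorm => x.
by rewrite /= patchE; case: ifP.
Qed.

(** Makes the dual norm a supremum over a nonempty set, hence nonnegative; see [dual_norm_gap]. *)
Lemma in_X0 : open Omega -> in_X Omega p (0 : wfuns R N m).
Proof.
move=> oO i; have pi0 : (p i)%:E != 0%E by rewrite eqe gt_eqF//; have := p1 i; lra.
have E0 : (0 : wfuns R N m) i = ((fun=> 0), (fun=> 0)) by [].
have nW : norm_W Omega (p i) ((fun=> 0), (fun=> 0)) = 0%E.
  rewrite /norm_W /grad /=; under [fun x => _]eq_fun do rewrite enorm0.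
  exact: norm_Lp0.
have mc (f : 'rV[R]_N -> R) : (forall x, f x = 0) -> meas_on Omega f.
  by move=> f0; have -> : f = cst 0 by [apply/funext]; exact: measurable_cst.
have int0 (f : 'rV[R]_N -> R) : (forall x, f x = 0) -> \int[leb R N]_(x in Omega) f x = 0.
  by move=> f0; rewrite /Rintegral (eq_integral (cst 0%E)) ?integral0// => x _; rewrite f0.
rewrite E0; split; [split; [split|]|].
- by split; [exact: mc|rewrite norm_Lp0 ?ltry].
- by move=> j; apply: mc => x; rewrite mxE.
- by rewrite nW ltry.
- move=> phi _ j /=.
  rewrite !int0 ?oppr0// => x; rewrite ?mul0r//.
  by rewrite mxE mul0r.
- move=> e e0; exists (cst 0); split; first exact: test_function0.
  have -> : ((fun=> 0), (fun=> 0)) - (cst 0, gradient (cst 0)) = ((fun=> 0), (fun=>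
    0)) :> wfun R N.
    congr pair; apply/funext => x /=; first by rewrite /= subr0.
    by apply/rowP => j; rewrite !mxE partial0 subr0.
  by rewrite /= [X in (X + _)%E]norm_Lp0// add0e [X in (X < _)%E]nW lte_fin.
by split; [exact: mc|rewrite norm_Lp0 ?ltry].
Qed.

End zero.

(** * The functional on the space X *)

Section functional_on_X.
Variables (R : realType) (N m : nat) (Omega : set 'rV[R]_N)
    (p : 'I_m -> R) (A : 'I_m -> 'rV[R]_N -> R -> 'rV[R]_N -> R)
    (G : 'rV[R]_N -> 'rV[R]_m -> R).
Hypotheses (bO : bounded_domain Omega) (p1 : forall i, 1 < p i)
  (cA : forall i, C1_Caratheodory Omega
     (fun x (w : R^o * 'rV[R]_N) => A i x w.1 w.2))
  (gA : forall i, growth_A Omega (p i) (A i))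
  (cG : C1_Caratheodory Omega G)
  (G0 : in_Lp Omega +oo%E (fun x => G x 0))
  (gG : growth_G Omega G).
Local Notation E := 'rV[R]_N.
Local Notation T := (lebT R N).
Local Notation mu := (leb R N).
Local Notation X := (in_X Omega p).

(** The data retyped over [lebT], so that the results on complete measure spaces apply. *)
Let a (i : 'I_m) (x : T) (w : R^o * E) : R := A i x w.1 w.2.
Let g (x : T) : 'rV[R]_m -> R := G x.
Let D : set T := Omega.

Let mD : measurable D. Proof. by case: bO => _ oO _ _; exact: open_lebesgue_measurable. Qed.
Let muD : (mu D < +oo)%E. Proof. by case: bO => _ _ _; exact: bounded_lebesgue_finite. Qed.
Let cmu : measure_is_complete mu. Proof. exact: leb_complete. Qed.
Let ma : forall i w, measurable_fun D (a i ^~ w). Proof. by move=> i; exact: (cA i).1. Qed.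
Let ca : forall i, \forall x \ae mu, D x -> C1 (a i x). Proof. by move=> i;
  exact: (cA i).2. Qed.
Let mg : forall w, measurable_fun D (g ^~ w). Proof. exact: cG.1. Qed.
Let cg : \forall x \ae mu, D x -> C1 (g x). Proof. exact: cG.2. Qed.
Let ga : forall i (M : R), exists2 C : R, 0 <= C &
  \forall x \ae mu, D x -> forall (t : R) (xi : 'rV[R]_N), `|t| <= M ->
  [/\ `|a i x (t, xi)| <= C * (1 + enorm xi `^ p i),
      `|'d (a i x) ((t, xi) : R^o * E) (1, 0)| <= C * (1 + enorm xi `^ p i) &
      forall j : 'I_N, `|'d (a i x) ((t, xi) : R^o * E) (0, delta_mx 0 j)| <=
        C * (1 + enorm xi `^ (p i - 1)) ].
Proof. by move=> i; exact: (growth_A_bound (cA i) (gA i)). Qed.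
Let gg : forall M : R, exists2 C : R, 0 <= C &
  \forall x \ae mu, D x -> forall w : 'rV[R]_m, (forall i, `|w 0 i| <= M) ->
  `|g x w| <= C /\ forall i, `|'d (g x) w (delta_mx 0 i)| <= C.
Proof. exact: (growth_G_bound cG G0 gG). Qed.

(** Elements of [wfuns] are already families of pairs (function, field), so this is the identity. *)
Let st (u : wfuns R N m) : state T R N m := u.

Lemma in_X_measurable u : X u -> measurable_state D (st u).
Proof. by move=> Xu i; have [[[[h _] h' _ _] _] _] := Xu i; split. Qed.

Lemma in_X_Linfty u i : X u -> exists2 k : R, 0 <= k & (norm_Lp Omega +oo (u i).1 = k%:E)%E.
Proof.
move=> Xu; have [_ [_ h]] := Xu i.
have h0 : (0 <= norm_Lp Omega +oo (u i).1)%E by exact: Lnorm_ge0.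
exists (fine (norm_Lp Omega +oo%E (u i).1)); first exact: fine_ge0.
by rewrite fineK// ge0_fin_numE.
Qed.

(** The L^oo part of X bounds the values, and the finite W-norm makes the powers of the gradients
    integrable. *)
Lemma in_X_admissible u : X u -> admissible mu D p (st u).
Proof.
move=> Xu; apply: (admissibleP mD muD); first exact: in_X_measurable.
  move=> i; have [k _ hk] := in_X_Linfty i Xu.
  by exists k; apply: ae_le_norm_Linfty; rewrite hk.
move=> i; have mi := in_X_measurable Xu i; have pi1 := p1 i.
have pi0 : p i != 0 by rewrite gt_eqF//; lra.
apply/integrableP; split.
  by apply/measurable_EFinP; exact: measurable_enorm_powR mi.2.
have [[[_ _ h _] _] _] := Xu i.
have -> : (\int[mu]_(x in D) `|(enorm ((st u i).2 x) `^ p i)%:E| = norm_W Omega (p i) (u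
  i) `^ p i)%E.
  rewrite -[RHS](integral_Lp_norm mu D (fun x : T => enorm ((st u i).2 x)) pi0).
  apply: eq_integral => x _ /=.
  by rewrite ger0_norm ?powR_ge0// ger0_norm// enorm_ge0.
exact: poweR_lty.
Qed.

(** The integrands agree where A_i(x, .) and G(x, .) are C^1, that is almost everywhere. Asking of v
    only measurability allows the direction c v + w in [J_Frechet]. *)
Lemma dJE u v : X u -> measurable_state D (st v) ->
  dJ Omega A G u v = daction mu D a g (st u) (st v).
Proof.
move=> Xu mv; have su := in_X_measurable Xu.
rewrite /dJ /daction; apply: eq_bigr => i _; congr (_ + _ - _).
- apply: (ae_eq_Rintegral cmu mD (f := fun x : T =>
    dotv (A_xi (A i) x ((u i).1 x) (grad (u i) x)) (grad (v i) x))).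
    apply: measurable_sum => j; apply: measurable_funM; last exact: (mv i).2.
    exact: (measurable_dxi cmu mD ma ca su).
  apply: ae_onS (cA i).2 => x Ox [dA _].
  by apply: eq_bigr => j _; rewrite /A_xi /gradient mxE (partial_diff (f := fun w :
    R^o * E => A i x w.1 w.2)).
- apply: (ae_eq_Rintegral cmu mD (f := fun x : T =>
    A_t (A i) x ((u i).1 x) (grad (u i) x) * (v i).1 x)).
    apply: measurable_funM; last exact: (mv i).1.
    exact: (measurable_dt cmu mD ma ca su).
  apply: ae_onS (cA i).2 => x Ox [dA _].
  by rewrite /A_t (derive1_diff (f := fun w : R^o * E => A i x w.1 w.2)).
- apply: (ae_eq_Rintegral cmu mD (f := fun x : T => G_u G i x (vals u x) * (v i).1 x)).
    apply: measurable_funM; last exact: (mv i).1.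
    exact: (measurable_dG cmu mD mg cg su).
  by apply: ae_onS cG.2 => x Ox [dG _]; rewrite /G_u /partial deriveE.
Qed.

Lemma norm_W_le_normX (v : wfuns R N m) i : (norm_W Omega (p i) (v i) <= normX Omega p v)%E.
Proof.
rewrite /normX /normW (bigD1 i)//= -addeA leeDl// adde_ge0//.
  by apply: sume_ge0 => j _; exact: Lnorm_ge0.
by apply: sume_ge0 => j _; exact: Lnorm_ge0.
Qed.

Lemma norm_Linfty_le_normL (v : wfuns R N m) i :
  (norm_Lp Omega +oo (v i).1 <= normL Omega v)%E.
Proof. by rewrite /normL (bigD1 i)//= leeDl// sume_ge0// => j _; exact: Lnorm_ge0. Qed.

Lemma normL_le_normX (v : wfuns R N m) : (normL Omega v <= normX Omega p v)%E.
Proof. by rewrite /normX leeDr// sume_ge0// => j _; exact: Lnorm_ge0. Qed.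

Lemma normX_small (v : wfuns R N m) (k : R) : (normX Omega p v <= k%:E)%E ->
  small_direction mu D p (st v) k.
Proof.
move=> vk; split=> i; first exact: le_trans (norm_W_le_normX v i) vk.
apply: ae_le_norm_Linfty; apply: le_trans (norm_Linfty_le_normL v i) _.
exact: le_trans (normL_le_normX v) vk.
Qed.

Lemma normX_ge0 (v : wfuns R N m) : (0 <= normX Omega p v)%E.
Proof. by rewrite adde_ge0// sume_ge0// => j _; exact: Lnorm_ge0. Qed.

Lemma dJ_gap w u v (k : R) : X w -> X u -> X v -> 0 <= k -> (normX Omega p v <= k%:E)%E ->
  (`|dJ Omega A G w v - dJ Omega A G u v|%:E <= gap mu D p a g (st w) (st u) * k%:E)%E.
Proof.
move=> Xw Xu Xv k0 vk; have mv := in_X_measurable Xv; rewrite !dJE//.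
have [M [Q [eQ wQ uQ vQ]]] := admissible_join3 mD (in_X_admissible Xw) (in_X_admissible
  Xu) (in_X_admissible Xv).
exact: (daction_gap cmu mD p1 ma ca mg cg ga gg eQ wQ uQ vQ k0 (normX_small vk)).
Qed.

(** The lower bound tests with v = 0, which lies in the unit ball of X; the upper bound is [dJ_gap]
    with k = 1. *)
Lemma dual_norm_gap w u : X w -> X u ->
  (0 <= dual_norm X (normX Omega p) (fun v => dJ Omega A G w v - dJ Omega A G u v)%R <=
    gap mu D p a g (st w) (st u))%E.
Proof.
move=> Xw Xu; apply/andP; split.
  have X0 : X 0 by apply: in_X0 => //; case: bO.
  have n0 : (normX Omega p (0 : wfuns R N m) = 0)%E.
    rewrite /normX /normW /normL !big1 ?adde0// => i _; first exact: norm_Lp0.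
    rewrite /norm_W /grad/=; under [fun x => _]eq_fun do rewrite enorm0.
    by apply: norm_Lp0; rewrite eqe gt_eqF//; have := p1 i; lra.
  apply: (@le_trans _ _ (`|dJ Omega A G w 0 - dJ Omega A G u 0|%:E)%E);
    first by rewrite lee_fin.
  by apply: ereal_sup_ubound; exists 0 => //; split => //; rewrite n0 lee_fin.
apply: ge_ereal_sup => _ [v [Xv v1] <-].
by have := dJ_gap Xw Xu Xv ler01 v1; rewrite mule1.
Qed.


Lemma grad_dist_le_normW (w u : wfuns R N m) i :
  (grad_dist mu D p (st w) (st u) i <= normW Omega p (w - u))%E.
Proof.
rewrite /normW (bigD1 i)//=.
apply: (@le_trans _ _ (norm_W Omega (p i) ((w - u) i))); first exact: lexx.
by rewrite leeDl// sume_ge0// => j _; exact: Lnorm_ge0.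
Qed.

Lemma near_cvg_J_gap (un : nat -> wfuns R N m) u (M e : R) : 0 < e ->
  (forall n, X (un n)) -> X u -> normW Omega p (un n - u) @[n --> \oo] --> 0%E ->
  ae_on Omega (fun x => forall i, (un n i).1 x @[n --> \oo] --> (u i).1 x) ->
  (forall n, (normL Omega (un n) <= M%:E)%E) ->
  \forall n \near \oo, `|J Omega A G (un n) - J Omega A G u| < e /\
    (gap mu D p a g (st (un n)) (st u) < e%:E)%E.
Proof.
move=> e0 Xun Xu nW cu uM.
apply: (near_cvg_action_gap cmu mD p1 ma ca mg cg ga gg (M := M) (U := un) e0).
- by move=> k; exact: in_X_measurable.
- exact: in_X_admissible.
- move=> k; apply: ae_on_ord => i; apply: ae_le_norm_Linfty.
  exact: le_trans (norm_Linfty_le_normL (un k) i) (uM k).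
- exact: cu.
- move=> i; apply: (@squeeze_cvge _ _ _ _ (cst 0%E) _ (fun n =>
    normW Omega p (un n - u))) => //.
    by apply: nearW => k; rewrite Lnorm_ge0/=; exact: grad_dist_le_normW.
  exact: cvg_cst.
Qed.

Lemma J_Frechet u : X u ->
  Frechet_differential X (normX Omega p) (J Omega A G) u (dJ Omega A G u).
Proof.
move=> Xu; have hu := in_X_admissible Xu; split; first split.
- move=> c v w Xv Xw; have hv := in_X_admissible Xv; have hw := in_X_admissible Xw.
  have mv := in_X_measurable Xv; have mw := in_X_measurable Xw.
  have E : st (c *: v + w) = shift_state (st w) c (st v).
    apply/funext => i; rewrite /shift_state /st; congr pair; apply/funext => x.
      by rewrite /= addrC.
    by rewrite /= addrC.
  have mE : measurable_state D (st (c *: v + w)) by rewrite E;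
    exact: measurable_shift_state.
  rewrite (dJE Xu mE) (dJE Xu mv) (dJE Xu mw).
  by rewrite E (daction_linear cmu mD p1 ma ca mg cg ga gg c hu hv hw).
(* The joint class M', Q' below varies with v, but [daction_norm] depends on u alone and so bounds
   the whole supremum. *)
- have [M [Q [eQ uQ]]] := hu.
  apply: le_lt_trans (daction_norm_lty cmu mD p1 ma ca mg cg ga gg eQ uQ).
  apply: ge_ereal_sup => _ [v [Xv v1] <-].
  rewrite (dJE Xu (in_X_measurable Xv)).
  have [M' [Q' [_ eQ' uQ' vQ']]] := admissible_join mD hu (in_X_admissible Xv).
  have := daction_le cmu mD p1 ma ca mg cg ga gg eQ' uQ' vQ' ler01 (normX_small v1).
  by rewrite mule1.
move=> e e0; have [r r0 hr] := action_frechet cmu mD p1 ma ca mg cg ga gg e0 hu.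
exists r => // v Xv vr.
(* Finiteness allows k to be the exact norm of v, so that the remainder is compared with e times
   this norm. *)
have vfin : normX Omega p v \is a fin_num.
  by rewrite ge0_fin_numE ?normX_ge0//; exact: lt_trans vr (ltry r).
have hv := in_X_admissible Xv.
have k0 : 0 <= fine (normX Omega p v) by rewrite fine_ge0// normX_ge0.
have kr : fine (normX Omega p v) < r by rewrite -lte_fin fineK.
have vk : (normX Omega p v <= (fine (normX Omega p v))%:E)%E by rewrite fineK.
have := hr _ _ k0 kr hv (normX_small vk).
rewrite -lee_fin EFinM fineK// (dJE Xu (in_X_measurable Xv)).
have -> // : shift_state (st u) 1 (st v) = st (u + v).
apply/funext => i; rewrite /shift_state /st; congr pair; apply/funext => x /=.
  by rewrite mul1r.
by rewrite scale1r.
Qed.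

(** Closeness in X controls both the gradients in L^{p_i} and the values in L^oo, the two inputs of
    [small_action_gap]. *)
Lemma dJ_continuous u (e : R) : X u -> 0 < e -> exists2 d : R, 0 < d &
    forall w, X w -> (normX Omega p (w - u) < d%:E)%E ->
      (dual_norm X (normX Omega p) (dJ Omega A G w \- dJ Omega A G u)%R < e%:E)%E.
Proof.
move=> Xu e0; have hu := in_X_admissible Xu.
have [r /andP[r0 r1] hr] := small_action_gap cmu mD p1 ma ca mg cg ga gg e0 hu.
exists r => // w Xw wr.
have /andP[_ /le_lt_trans] := dual_norm_gap Xw Xu; apply.
apply: hr; first exact: in_X_measurable.
  move=> i; apply: le_trans (grad_dist_le_normW w u i) _; apply: le_trans (ltW wr).
  by rewrite /normX leeDl// sume_ge0// => j _; exact: Lnorm_ge0.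
move=> i; exact: (normX_small (ltW wr)).2 i.
Qed.

End functional_on_X.

Theorem proposition3p5 (R : realType) (N m : nat) (Omega : set 'rV[R]_N)
    (p : 'I_m -> R) (A : 'I_m -> 'rV[R]_N -> R -> 'rV[R]_N -> R)
    (G : 'rV[R]_N -> 'rV[R]_m -> R) :
  (2 <= N)%N -> (2 <= m)%N -> bounded_domain Omega -> (forall i, 1 < p i) ->
  (forall i, C1_Caratheodory Omega
     (fun x (w : R^o * 'rV[R]_N) => A i x w.1 w.2)) ->
  (forall i, growth_A Omega (p i) (A i)) ->
  C1_Caratheodory Omega G ->
  in_Lp Omega +oo%E (fun x => G x 0) ->
  (forall i, ae_on Omega (fun x => G_u G i x 0 = 0)) ->
  growth_G Omega G ->
  (forall (un : nat -> wfuns R N m) (u : wfuns R N m),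
     (forall n, in_X Omega p (un n)) -> in_X Omega p u ->
     normW Omega p (un n - u) @[n --> \oo] --> 0%E ->
     ae_on Omega (fun x => forall i,
       (un n i).1 x @[n --> \oo] --> (u i).1 x) ->
     (exists2 M : R, 0 < M & forall n, (normL Omega (un n) <= M%:E)%E) ->
     J Omega A G (un n) @[n --> \oo] --> J Omega A G u /\
     dual_norm (in_X Omega p) (normX Omega p)
       (fun v => dJ Omega A G (un n) v - dJ Omega A G u v)
       @[n --> \oo] --> 0%E) /\
  C1_functional_with (in_X Omega p) (normX Omega p)
    (J Omega A G) (dJ Omega A G).
Proof.
move=> _ _ bO p1 cA gA cG G0 _ gG; split; last first.
  split=> [u Xu|u Xu e e0]; first exact: J_Frechet.
  exact: dJ_continuous.
move=> un u Xun Xu nW cu [M _ uM].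
have near_gap (e : R) (e0 : 0 < e) := near_cvg_J_gap bO p1 cA gA cG G0 gG e0 Xun Xu nW cu uM.
split.
  by apply/cvgrPdist_lt => e e0; apply: filterS (near_gap e e0) => n [h _]; rewrite distrC.
(* The dual norm lies between 0 and [gap], so the same neighbourhoods of infinity serve both
   limits. *)
apply: squeeze_ereal0 => e e0; apply: filterS (near_gap e e0) => n [_ h].
have /andP[h0 h1] := dual_norm_gap bO p1 cA gA cG G0 gG (Xun n) Xu.
by split => //; exact: le_lt_trans h1 h.
Qed.
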